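(* Suppose that: (i) for every $s\in\mathcal U$ with a self loop, $(A_{ss},B_{ss})$ is stabilizable and $(A_{ss},C_{ss})$ is detectable, where $Q_{ss}=C_{ss}^\top C_{ss}$; (ii) $\sigma_m(R)\ge1$ and $\sigma_n(Q)\ge1$; (iii) $A$ is stable with $\|A^k\|\le\kappa_0\gamma_0^k$ for all $k\ge0$, $\kappa_0\ge1$, $\rho(A)<\gamma_0<1$; (iv) $\|\hat A-A\|\le\varepsilon$ and $\|\hat B-B\|\le\varepsilon$, where $\varepsilon>0$ satisfies $$\varepsilon\le\frac1{768}\frac{(1-\gamma^2)^2}{\kappa^4}\tilde\Gamma^{-11}(1+\sigma_1(R^{-1}))^{-2}\big(20\tilde\Gamma^9\sigma_1(R)\big)^{-D_{\max}}.$$ Then the cost $\tilde J$ of the policy $\tilde u$ (see context) satisfies $$\tilde J=\sigma_w^2\sum_{i\in\mathcal V,\ w_i\to s}\mathrm{Tr}\big(I_{\{i\},s}\tilde P_sI_{s,\{i\}}\big).$$ Moreover, for any $\varphi>0$, $$\tilde J-J_\star\le\frac{72\kappa^4\sigma_w^2npq}{(1-\gamma^2)^2}\tilde\Gamma^{4D_{\max}+8}(\Gamma^3+\sigma_1(R))(1+\sigma_1(R^{-1}))\big(20\tilde\Gamma^9\sigma_1(R)\big)^{D_{\max}}\varepsilon+\varphi.$$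
   Context: $\|\cdot\|$ is the spectral norm, $\sigma_1\ge\sigma_2\ge\cdots$ singular values, $\rho$ spectral radius; a matrix is stable if its spectral radius is less than 1. Networked system. Let $p\ge1$, $\mathcal V=\{1,\dots,p\}$. Subsystem $i$ has state in $\mathbb R^{n_i}$ and input in $\mathbb R^{m_i}$, $n_i\ge m_i$; $n=\sum_i n_i$, $m=\sum_i m_i$. The stacked system is $x(t+1)=Ax(t)+Bu(t)+w(t)$, $x(0)=0$, where $A=(A_{ij})\in\mathbb R^{n\times n}$, $B=(B_{ij})\in\mathbb R^{n\times m}$ have blocks $A_{ij}\in\mathbb R^{n_i\times n_j}$, $B_{ij}\in\mathbb R^{n_i\times m_j}$ with $A_{ij}=0$, $B_{ij}=0$ if $j\notin\mathcal N_i$ ($\mathcal N_i\subseteq\mathcal V$ is the set of subsystems directly affecting $i$), and $w(t)$, $t\ge0$, are i.i.d. $\mathcal N(0,\sigma_w^2I)$, $\sigma_w>0$. Delays. $\mathcal G(\mathcal V,\mathcal A)$ is a directed graph without self loops, each edge carrying a delay $0$ or $1$, with no directed cycle of total delay zero. $D_{ii}=0$; for $i\ne j$, $D_{ij}$ is the smallest total delay of a directed path from $j$ to $i$ ($+\infty$ if none). Standing assumption: $D_{ij}\le1$ for all $i$ and $j\in\mathcal N_i$. $D_{\max}$ is the maximum of $D_{ij}$ over pairs such that there is a directed path from $j$ to $i$ (equivalently over finite $D_{ij}$). Information graph. $s_j(k)=\{i\in\mathcal V:D_{ij}\le k\}$, $\mathcal U=\{s_j(k):k\ge0,j\in\mathcal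 V\}$, edges $s_j(k)\to s_j(k+1)$. Every $r\in\mathcal U$ has exactly one outgoing edge $r\to s$ (possibly a self loop); the graph is a forest of trees oriented toward roots, and the set $\mathcal R$ of roots is the set of nodes with a self loop. Write $w_i\to s$ iff $s=s_i(0)$ (for such $s$, $i$ is unique). $q=|\mathcal U|$. Submatrices. For $s,r\subseteq\mathcal V$, $A_{sr}$ (or $A_{s,r}$) is the submatrix of block rows $s$ and block columns $r$; likewise for $B,Q,R,I,\hat A,\hat B$. Cost and optimal gains. $Q\succeq0$ is $n\times n$, $R\succ0$ is $m\times m$. The decentralized problem is to minimize $\lim_{T\to\infty}\mathbb E[\frac1T\sum_{t<T}(x^\top Qx+u^\top Ru)(t)]$ over policies with $u_i(t)$ a function of $\{x_j(k):D_{ij}\ne\infty,0\le k\le t-D_{ij}\}$. For $r\to s$, $$K_r=-(R_{rr}+B_{sr}^\top P_sB_{sr})^{-1}B_{sr}^\top P_sA_{sr},\quad P_r=Q_{rr}+K_r^\top R_{rr}K_r+(A_{sr}+B_{sr}K_r)^\top P_s(A_{sr}+B_{sr}K_r),$$ where for $s$ with a self loop $P_s$ is the unique positive semidefinite solution of the resulting Riccati equation (then $A_{ss}+B_{ss}K_s$ is stable). The optimal cost is $J_\star=\sigma_w^2\sum_{i\in\mathcal V,\,w_i\to s}\mathrm{Tr}(I_{\{i\},s}P_sI_{s,\{i\}})$. Constants. For $s\in\mathcal R$ fix $\kappa_s\ge1$, $\rho(A_{ss}+B_{ss}K_s)<\gamma_s<1$ with $\|(A_{ss}+B_{ss}K_s)^k\|\le\kappa_s\gamma_s^k$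 for all $k\ge0$. $\gamma=\max\{\max_{s\in\mathcal R}\gamma_s,\gamma_0\}$, $\kappa=\max\{\max_{s\in\mathcal R}\kappa_s,\kappa_0\}$, $\Gamma=\max\{\|A\|,\|B\|,\max_{s\in\mathcal U}\|P_s\|,\max_{s\in\mathcal U}\|K_s\|\}$, $\tilde\Gamma=\Gamma+1$. Estimated gains and auxiliary policy. $\hat A\in\mathbb R^{n\times n}$, $\hat B\in\mathbb R^{n\times m}$ are fixed matrices. $\hat K_r,\hat P_r$ are defined by the same recursions as $K_r,P_r$ with $A,B$ replaced by $\hat A,\hat B$ (for self-loop nodes $\hat P_r$ is the positive semidefinite solution of the resulting Riccati equation). The policy $\tilde u$ is $\tilde u_i(t)=\sum_{s\ni i}I_{\{i\},s}\hat K_s\tilde\zeta_s(t)$ with $\tilde\zeta_s(0)=0$ and $\tilde\zeta_s(t+1)=\sum_{r\to s}(A_{sr}+B_{sr}\hat K_r)\tilde\zeta_r(t)+\sum_{w_i\to s}I_{s,\{i\}}w_i(t)$; the state is $\tilde x(t+1)=A\tilde x(t)+B\tilde u(t)+w(t)$, $\tilde x(0)=0$, and $\tilde J=\lim_{T\to\infty}\mathbb E[\frac1T\sum_{t=0}^{T-1}(\tilde x(t)^\top Q\tilde x(t)+\tilde u(t)^\top R\tilde u(t))]$. Matrices $\tilde P_r$ are defined recursively, for $r\to s$, by $\tilde P_r=Q_{rr}+\hat K_r^\top R_{rr}\hat K_r+(A_{sr}+B_{sr}\hat K_r)^\top\tilde P_s(A_{sr}+B_{sr}\hat K_r)$ (for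 $r=s$ a Lyapunov equation in $\tilde P_s$). *)

(* Defs.v *)
From HB Require Import structures.
From mathcomp Require Export all_boot all_order all_algebra.
From mathcomp Require Export complex.
From mathcomp Require Export all_classical all_reals all_analysis.

#[export] Set Implicit Arguments.
#[export] Unset Strict Implicit.
#[export] Unset Printing Implicit Defensive.

Import Order.TTheory GRing.Theory Num.Theory.
Import numFieldNormedType.Exports.

Local Open Scope ring_scope.

(* A term satisfying [S], or the junk value [x0] if there is none. *)
Definition the (T : Type) (x0 : T) (S : T -> Prop) : T :=
  if pselect (exists x, S x) is left exS then projT1 (cid exS) else x0.

Section Spectrum.
Context {R : realType}.

(* Complex eigenvalues, repeated according to algebraic multiplicity. *)
Definition eigenvalues n (M : 'M[R]_n) : seq R[i] :=
  sval (closed_field_poly_normal (char_poly (map_mx (real_complex R) M))).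

Definition spectral_radius n (M : 'M[R]_n) : R :=
  \big[Num.max/0]_(z <- eigenvalues M) Normc.normc z.

Definition stable n (M : 'M[R]_n) : Prop := spectral_radius M < 1.

(* For [M] with [n] columns this list has length [n]; if there are fewer than
   [n] rows it is the usual list of singular values padded with zeros. *)
Definition singular_values m n (M : 'M[R]_(m, n)) : seq R :=
  sort >=%R [seq Num.sqrt (complex.Re z) | z <- eigenvalues (M^T *m M)].

(* The [k]-th largest singular value, with [k] starting from 1. *)
Definition sigma k m n (M : 'M[R]_(m, n)) : R := nth 0 (singular_values M) k.-1.

Definition specnorm m n (M : 'M[R]_(m, n)) : R := sigma 1 M.

Definition psd n (M : 'M[R]_n) : Prop :=
  M^T = M /\ forall x : 'cV[R]_n, 0 <= (x^T *m M *m x) 0 0.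

Definition pd n (M : 'M[R]_n) : Prop :=
  M^T = M /\ forall x : 'cV[R]_n, x != 0 -> 0 < (x^T *m M *m x) 0 0.

Definition stabilizable n m (A : 'M[R]_n) (B : 'M[R]_(n, m)) : Prop :=
  exists K : 'M[R]_(m, n), stable (A + B *m K).

Definition detectable n l (A : 'M[R]_n) (C : 'M[R]_(l, n)) : Prop :=
  exists L : 'M[R]_(n, l), stable (A + L *m C).

End Spectrum.

(* Coordinates (in the stacked space) of the subsystems in [s]. *)
Definition coords p (d_ : 'I_p -> nat) (s : {set 'I_p}) :
    {set 'I_(\sum_i d_ i)} :=
  finset (fun k => tagnat.sig1 k \in s).

(* Submatrix of block rows [s] and block columns [r]. *)
Definition subm {R : Type} p (a_ b_ : 'I_p -> nat)
    (M : 'M[R]_(\sum_i a_ i, \sum_i b_ i)) (s r : {set 'I_p}) :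
    'M[R]_(#|coords a_ s|, #|coords b_ r|) :=
  mxsub enum_val enum_val M.

Definition subv {R : Type} p (a_ : 'I_p -> nat) (v : 'cV[R]_(\sum_i a_ i))
    (s : {set 'I_p}) : 'cV[R]_(#|coords a_ s|) :=
  rowsub enum_val v.

(* The stacked vector with block [f i] at the coordinates of subsystem [i]. *)
Definition stack {R : realType} p (a_ : 'I_p -> nat)
    (f : forall i : 'I_p, 'cV[R]_(#|coords a_ [set i]%SET|)) :
    'cV[R]_(\sum_i a_ i) :=
  \sum_i colsub enum_val 1%:M *m f i.

Record delay_graph (p : nat) := DelayGraph {
  edge : rel 'I_p;
  delay : 'I_p -> 'I_p -> nat  (* relevant on edges only *)
}.

Section InformationGraph.
Context {p : nat} (G : delay_graph p).

(* Total delay of the walk [x :: s]. *)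
Fixpoint walk_delay (x : 'I_p) (s : seq 'I_p) : nat :=
  if s is y :: s' then (delay G x y + walk_delay y s')%N else 0%N.

Definition delay_graph_wf : Prop :=
  [/\ forall i, ~~ edge G i i,
      forall i j, edge G i j -> (delay G i j <= 1)%N
    & forall x s, s != [::] -> uniq s -> path (edge G) x s -> last x s = x ->
        (0 < walk_delay x s)%N].

Definition has_walk (j i : 'I_p) (d : nat) : bool :=
  `[< exists s, [/\ path (edge G) j s, last j s = i & walk_delay j s = d] >].

(* [D i j] is the smallest total delay from [j] to [i], and [None] stands for
   [+oo]; the empty walk gives [D i i = Some 0]. *)
Definition D (i j : 'I_p) : option nat :=
  if pselect (exists d, has_walk j i d) is left h then Some (ex_minn h) else None.

Definition D_le (i j : 'I_p) (k : nat) : bool := oapp (leq^~ k) false (D i j).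

Definition Dmax : nat := \max_i \max_j odflt 0%N (D i j).

Definition info (j : 'I_p) (k : nat) : {set 'I_p} := finset (fun i => D_le i j k).

Definition nodes : {set {set 'I_p}} :=
  finset (fun r => `[< exists j k, r = info j k >]).

Definition info_edge (r s : {set 'I_p}) : bool :=
  `[< exists j k, r = info j k /\ s = info j k.+1 >].

(* The end of the only edge leaving [r] (junk when [r] is not a node). *)
Definition succ (r : {set 'I_p}) : {set 'I_p} :=
  odflt r [pick s | info_edge r s].

Definition roots : {set {set 'I_p}} :=
  finset (fun s => (s \in nodes) && info_edge s s).

End InformationGraph.

Section Recursions.
Context {R : realType} {p : nat} (G : delay_graph p).
Context {n_ m_ : 'I_p -> nat}.
Context (Q : 'M[R]_(\sum_i n_ i)) (Ru : 'M[R]_(\sum_i m_ i)).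
Context (A : 'M[R]_(\sum_i n_ i)) (B : 'M[R]_(\sum_i n_ i, \sum_i m_ i)).

Definition cost_family := forall r : {set 'I_p}, 'M[R]_(#|coords n_ r|).
Definition gain_family :=
  forall r : {set 'I_p}, 'M[R]_(#|coords m_ r|, #|coords n_ r|).

Definition closed_loop (K : gain_family) (s r : {set 'I_p}) :
    'M[R]_(#|coords n_ s|, #|coords n_ r|) :=
  subm A s r + subm B s r *m K r.

Definition gain (P : cost_family) : gain_family := fun r =>
  let s := succ G r in
  - (invmx (subm Ru r r + (subm B s r)^T *m P s *m subm B s r)
       *m (subm B s r)^T *m P s *m subm A s r).

Definition cost_step (K : gain_family) (P : cost_family) : cost_family := fun r =>
  let s := succ G r in
  subm Q r r + (K r)^T *m subm Ru r r *m K r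
  + (closed_loop K s r)^T *m P s *m closed_loop K s r.

(* At a root, [succ G s = s] and the equation is the algebraic Riccati equation;
   at the other nodes it determines [P r] from [P (succ G r)]. *)
Definition is_riccati_family (P : cost_family) : Prop :=
  (forall r, r \in nodes G -> P r = cost_step (gain P) P r) /\
  (forall s, s \in roots G -> psd (P s)).

Definition riccati_cost : cost_family := the (fun=> 0) is_riccati_family.
Definition riccati_gain : gain_family := gain riccati_cost.

Definition is_lyapunov_family (K : gain_family) (P : cost_family) : Prop :=
  forall r, r \in nodes G -> P r = cost_step K P r.

Definition lyapunov_cost (K : gain_family) : cost_family :=
  the (fun=> 0) (is_lyapunov_family K).

(* [w_i -> s] means [s = info G i 0].  On the Riccati family this is the optimal
   decentralized cost. *)
Definition trace_cost (sw : R) (P : cost_family) : R :=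
  sw ^+ 2 * \sum_(i < p)
    let s := info G i 0 in
    \tr (subm (1%:M : 'M[R]_(\sum_i n_ i)) [set i]%SET s *m P s
           *m subm (1%:M : 'M[R]_(\sum_i n_ i)) s [set i]%SET).

Context (K : gain_family) (w : nat -> 'cV[R]_(\sum_i n_ i)).

(* The internal state uses the true [A] and [B]; [K] is the gain applied. *)
Fixpoint zeta (t : nat) (s : {set 'I_p}) : 'cV[R]_(#|coords n_ s|) :=
  if t is t'.+1 then
    \sum_(r in nodes G | info_edge G r s) closed_loop K s r *m zeta t' r
    + \sum_(i | s == info G i 0)
        subm (1%:M : 'M[R]_(\sum_i n_ i)) s [set i]%SET *m subv (w t') [set i]%SET
  else 0.

Definition input (t : nat) : 'cV[R]_(\sum_i m_ i) :=
  stack (fun i => \sum_(s in nodes G | i \in s)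
    subm (1%:M : 'M[R]_(\sum_i m_ i)) [set i]%SET s *m K s *m zeta t s).

Fixpoint state (t : nat) : 'cV[R]_(\sum_i n_ i) :=
  if t is t'.+1 then A *m state t' + B *m input t' + w t' else 0.

Definition stage_cost (t : nat) : R :=
  ((state t)^T *m Q *m state t + (input t)^T *m Ru *m input t) 0 0.

End Recursions.

Section Probability.
Context {R : realType} {dO : measure_display} {Omega : measurableType dO}.
Context (Pr : probability Omega R).

Definition vec_sigma_algebra n (X : Omega -> 'cV[R]_n) : set (set Omega) :=
  <<s (fun F => exists k (E : set R), measurable E /\
         F = ((fun o => X o k 0) @^-1` E)%classic) >>.

(* [X] has law N(0, sw^2 I), i.e. the product of [n] copies of N(0, sw^2). *)
Definition gaussian_vector n (sw : R) (X : Omega -> 'cV[R]_n) : Prop :=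
  forall E : 'I_n -> set R, (forall k, measurable (E k)) ->
    Pr (\bigcap_k (fun o => X o k 0) @^-1` E k)%classic
    = (\prod_k normal_prob 0 sw (E k))%E.

(* The [F t] may be the whole space, so the product rule over initial segments
   covers every finite set of times. *)
Definition independent_sequence n (w : nat -> Omega -> 'cV[R]_n) : Prop :=
  forall (T : nat) (F : nat -> set Omega),
    (forall t, vec_sigma_algebra (w t) (F t)) ->
    Pr (\bigcap_(t in `I_T) F t)%classic = (\prod_(t < T) Pr (F t))%E.

Definition iid_gaussian n (sw : R) (w : nat -> Omega -> 'cV[R]_n) : Prop :=
  [/\ forall t k, measurable_fun [set: Omega]%classic (fun o => w t o k 0),
      forall t, gaussian_vector sw (w t)
    & independent_sequence w].

Definition mean_cost {p : nat} (G : delay_graph p) {n_ m_ : 'I_p -> nat}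
    (Q : 'M[R]_(\sum_i n_ i)) (Ru : 'M[R]_(\sum_i m_ i))
    (A : 'M[R]_(\sum_i n_ i)) (B : 'M[R]_(\sum_i n_ i, \sum_i m_ i))
    (K : gain_family) (w : nat -> Omega -> 'cV[R]_(\sum_i n_ i)) (T : nat) : \bar R :=
  'E_Pr[(fun o => (T%:R^-1 *
           \sum_(t < T) stage_cost G Q Ru A B K (fun t' => w t' o) t)%R)]%E.

End Probability.

(* Main.v *)
Require Import Defs.
From mathcomp Require Import spectral ring lra zify.
From mathcomp Require Import measurable_realfun.
Import Order.TTheory GRing.Theory Num.Theory.
Import numFieldNormedType.Exports.
Local Open Scope ring_scope.

(** Costs-to-go are compared as quadratic forms, at all nodes of the information
graph at once. For gains K let M_r = Q_rr + K_r^T R_rr K_r be the stage cost at a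
node r and L_r the closed loop from r to its successor s. The optimal costs and the
costs of a fixed policy both satisfy P_r = M_r + L_r^T P_s L_r, and M_r >= Q_rr >= I.

The key fact is a perturbation bound for such families. If P <= g I and every closed
loop moves by at most dl in norm, to L', then Young's inequality gives
L'^T P L' <= L^T P L + 3 g dl I, and since I <= M this error is absorbed by the stage
cost: (1 - 3 g dl) M + L'^T P L' <= P ([perturbed_supersolution]). So P is, up to the
factor 1 - 3 g dl, a supersolution of the perturbed recursion; every bounded family
with X <= M + L'^T X L' lies below P / (1 - 3 g dl) ([perturbed_compare]), and P is
contracted along L' ([perturbed_contraction]).

This is used twice. Applying the optimal gains K to the estimated system costs at
least the estimated optimum Phat, by completing the square ([fstep_gain]); hence
Phat <= P / (1 - 3 g (g+1) eps) ([riccati_le]). Applying the estimated gains Khat to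
the true system instead of the estimated one gives Ptilde <= Phat / (1 - 12 g (g+1) eps)
([lyapunov_le]). Together Ptilde - P <= 30 g^2 (g+1) eps I with g = Gam
([certainty_equivalent_gap]). The traces over the subsystems add up to the state
dimension n, and the remaining factors of the claimed bound are all at least 1
([gap_constant]).

The families exist for the same reason. Value iteration started at 0 increases and stays
below any supersolution, so it converges to a solution ([riccati_exists]). For the
true system the decay of the powers of A provides a supersolution
([stable_supersolution]); for the estimated system, and for the Lyapunov equation of
the estimated gains, a multiple of the previous family is one.

For the formula of the cost, the internal states are linear in the noise:
zeta_s(t) is the sum over k < t of H_k(s) w(t-1-k). A node has only one successor, so
H_k(s) H_k(s')^T = 0 for distinct nodes ([impulse_orth]): the internal states of
different nodes are uncorrelated, and the expected stage cost at time t is sw^2 times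
the sum over k < t and over the nodes of the traces of H_k^T M H_k. By the Lyapunov
equation this sum telescopes to the trace of the theorem minus a remainder ([energy_lyapunov]), which tends to 0 by
the contraction above. The average over time has the same limit, by Cesaro's theorem
([mean_cost_cvg]). *)

(** * Quadratic forms and singular values *)

Section Quadratic.
Context {R : realType}.

Definition qf n (P : 'M[R]_n) (x : 'cV[R]_n) : R := (x^T *m P *m x) 0 0.
Definition sqn n (x : 'cV[R]_n) : R := (x^T *m x) 0 0.

Lemma sqnE n (x : 'cV[R]_n) : sqn x = \sum_i x i 0 ^+ 2.
Proof. by rewrite /sqn mxE; apply: eq_bigr => i _; rewrite mxE expr2. Qed.

Lemma sqn_ge0 n (x : 'cV[R]_n) : 0 <= sqn x.
Proof. by rewrite sqnE sumr_ge0 // => i _; exact: sqr_ge0. Qed.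

Lemma sqn_eq0 n (x : 'cV[R]_n) : sqn x = 0 -> x = 0.
Proof.
rewrite sqnE => /psumr_eq0P h; apply/colP => i; rewrite mxE; apply/eqP.
by rewrite -sqrf_eq0 h // => j _; exact: sqr_ge0.
Qed.

Lemma inj_unitmx n (P : 'M[R]_n) :
  (forall x : 'cV[R]_n, P *m x = 0 -> x = 0) -> P \in unitmx.
Proof.
move=> inj; rewrite -unitmx_tr -row_free_unit -kermx_eq0.
apply/eqP/row_matrixP => i; rewrite row0; apply: trmx_inj; rewrite trmx0.
apply: inj; apply: trmx_inj.
by rewrite trmx0 trmx_mul trmxK -row_mul mulmx_ker row0.
Qed.

Lemma qf_id n (x : 'cV[R]_n) : qf 1%:M x = sqn x.
Proof. by rewrite /qf mulmx1. Qed.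

Lemma qf_congr m n (M : 'M[R]_m) (L : 'M[R]_(m, n)) x :
  qf (L^T *m M *m L) x = qf M (L *m x).
Proof. by rewrite /qf trmx_mul !mulmxA. Qed.

Lemma qf_gram m n (M : 'M[R]_(m, n)) x : qf (M^T *m M) x = sqn (M *m x).
Proof. by rewrite /qf /sqn trmx_mul !mulmxA. Qed.

(** Over R[i] the form is diagonal in a unitary basis V of eigenvectors; the weights
c are the squared moduli of the coordinates of V x. All extremal bounds below compare
two such weighted sums term by term. *)
Lemma spectral_expansion n (S : 'M[R]_n) (x : 'cV[R]_n) : S^T = S ->
  exists (d : 'I_n -> R[i]) (c : 'I_n -> R),
    [/\ forall i, d i \in eigenvalues S, forall i, 0 <= c i,
        sqn x = \sum_i c i & qf S x = \sum_i complex.Re (d i) * c i].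
Proof.
move=> symS.
pose f := real_complex R.
pose SC := map_mx f S.
have fconj (r : R) : Num.conj (f r) = f r by apply/eqP; rewrite eq_complex /= oppr0 !eqxx.
have fmxconj m k (M : 'M[R]_(m, k)) : map_mx Num.conj (map_mx f M) = map_mx f M.
  by apply/matrixP => i j; rewrite !mxE.
have tSC : SC^T = SC by rewrite /SC map_trmx symS.
have symSC : SC \is normalmx by apply/normalmxP; rewrite tSC fmxconj.
have /orthomx_spectralP := symSC.
set V := spectralmx SC; set sp := spectral_diag SC => SCE.
have Vu : V \is unitarymx by exact: spectral_unitarymx.
have VV : V *m map_mx Num.conj V^T = 1%:M by apply/unitarymxP.
have VV' : map_mx Num.conj V^T *m V = 1%:M by exact: mulmx1C.
have Vinv : invmx V = map_mx Num.conj V^T by rewrite -invmx_unitary.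
pose y := V *m map_mx f x.
have key (d : 'rV[R[i]]_n) (M : 'M[R]_n) :
    map_mx f M = map_mx Num.conj V^T *m diag_mx d *m V ->
    f (qf M x) = \sum_i d 0 i * `|y i 0| ^+ 2.
  move=> ME; have -> : f (qf M x) = (map_mx f (x^T *m M *m x)) 0 0 by rewrite mxE.
  rewrite !map_mxM ME !mulmxA.
  have -> : map_mx f x^T *m map_mx Num.conj V^T = map_mx Num.conj y^T.
    by rewrite /y trmx_mul map_mxM map_trmx fmxconj.
  rewrite -mulmxA -/y mxE; apply: eq_bigr => i _; rewrite mul_mx_diag !mxE.
  by rewrite normCK; set a1 := \sum_j _; rewrite -mulrA mulrC -mulrA.
have nE : f (sqn x) = \sum_i `|y i 0| ^+ 2.
  rewrite -qf_id (key (const_mx 1)) ?diag_const_mx ?mulmx1 ?map_mx1 //.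
  by apply: eq_bigr => i _; rewrite mxE mul1r.
have sE : f (qf S x) = \sum_i sp 0 i * `|y i 0| ^+ 2.
  by apply: key; rewrite -Vinv -SCE.
have spev i : sp 0 i \in eigenvalues S.
  rewrite /eigenvalues; case: closed_field_poly_normal => r /= cp.
  have : eigenvalue SC (sp 0 i).
    apply/eigenvalueP; exists (row i V).
      rewrite -row_mul {1}SCE -/V !mulmxA mulmxV ?spectral_unit // mul1mx.
      by rewrite row_mul row_diag_mx -scalemxAl -rowE.
    have : V \in unitmx by exact: spectral_unit.
    rewrite -row_free_unit => /row_free_inj Vi; apply/negP => /eqP r0.
    have : (delta_mx 0 i : 'rV_n) *m V = 0 *m V by rewrite -rowE r0 mul0mx.
    move/Vi => /matrixP /(_ 0 i); by rewrite !mxE !eqxx /= => /eqP; rewrite oner_eq0.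
  rewrite eigenvalue_root_char {}cp rootZ; last first.
    by rewrite (monicP (char_poly_monic _)) oner_neq0.
  by rewrite root_prod_XsubC.
have hre i : complex.Re (sp 0 i * `|y i 0| ^+ 2) =
    complex.Re (sp 0 i) * complex.Re (`|y i 0| ^+ 2).
  rewrite -add_Re2_Im2 /=; case: (sp 0 i) => u v /=.
  by rewrite mulr0 subr0.
have hpos i : 0 <= complex.Re (`|y i 0| ^+ 2).
  by rewrite -add_Re2_Im2 /= addr_ge0 // sqr_ge0.
have {}nE : sqn x = \sum_i complex.Re (`|y i 0| ^+ 2).
  by rewrite -raddf_sum -nE.
have {}sE : qf S x = \sum_i complex.Re (sp 0 i) * complex.Re (`|y i 0| ^+ 2).
  rewrite -[LHS]/(complex.Re (f (qf S x))) sE raddf_sum.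
  by apply: eq_bigr => i _; exact: hre.
by exists (fun i => sp 0 i), (fun i => complex.Re (`|y i 0| ^+ 2)).
Qed.


Lemma size_singular_values m n (M : 'M[R]_(m, n)) : size (singular_values M) = n.
Proof.
rewrite size_sort size_map /eigenvalues.
case: closed_field_poly_normal => r /= /(congr1 (fun p : {poly _} => size p)).
rewrite (monicP (char_poly_monic _)) scale1r size_char_poly size_prod_XsubC.
by case.
Qed.

Lemma singular_values_sorted m n (M : 'M[R]_(m, n)) i j :
  (i <= j < n)%N -> nth 0 (singular_values M) j <= nth 0 (singular_values M) i.
Proof.
move=> /andP[ij jn].
have so : sorted >=%R (singular_values M).
  by apply: sort_sorted => a b /=; exact: le_total.
apply: (sorted_leq_nth _ _ _ so) => //.
- by move=> a b c /= ba ac; exact: le_trans ac ba.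
- by move=> a /=; exact: lexx.
- by rewrite inE size_singular_values (leq_ltn_trans ij).
- by rewrite inE size_singular_values.
Qed.


Lemma mem_singular_values m n (M : 'M[R]_(m, n)) z :
  z \in eigenvalues (M^T *m M) -> exists2 i, (i < n)%N &
    nth 0 (singular_values M) i = Num.sqrt (complex.Re z).
Proof.
move=> zM.
have : Num.sqrt (complex.Re z) \in singular_values M.
  by rewrite mem_sort; apply/mapP; exists z.
by case/(nthP (0 : R)) => i; rewrite size_singular_values; exists i.
Qed.

Lemma specnorm_ge0 m n (M : 'M[R]_(m, n)) : 0 <= specnorm M.
Proof.
rewrite /specnorm /sigma /=.
have : all (fun a => 0 <= a) (singular_values M).
  rewrite all_sort; apply/allP => _ /mapP[z _ ->]; exact: sqrtr_ge0.
by case: (singular_values M) => //= a l /andP[].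
Qed.

Lemma specnorm_bound m n (M : 'M[R]_(m, n)) x :
  sqn (M *m x) <= specnorm M ^+ 2 * sqn x.
Proof.
have tM : (M^T *m M)^T = M^T *m M by rewrite trmx_mul trmxK.
have [d [c [dev c0 -> E]]] := spectral_expansion x tM.
rewrite -qf_gram E mulr_sumr; apply: ler_sum => i _; apply: ler_wpM2r => //.
have [k kn kE] := mem_singular_values (dev i).
have le_s : Num.sqrt (complex.Re (d i)) <= specnorm M.
  by rewrite -kE; apply: singular_values_sorted.
have [d0|/ltW d0] := leP 0 (complex.Re (d i)); last first.
  by rewrite (le_trans d0) // sqr_ge0.
by rewrite -[leLHS]sqr_sqrtr // lerXn2r // nnegrE ?sqrtr_ge0 ?specnorm_ge0.
Qed.

Lemma sigma_min_bound m n (M : 'M[R]_(m, n)) x : 1 <= sigma n M ->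
  sqn x <= sqn (M *m x).
Proof.
move=> s1.
have tM : (M^T *m M)^T = M^T *m M by rewrite trmx_mul trmxK.
have [d [c [dev c0 -> E]]] := spectral_expansion x tM.
rewrite -qf_gram E; apply: ler_sum => i _; apply: ler_peMl => //.
have [k kn kE] := mem_singular_values (dev i).
have : sigma n M <= Num.sqrt (complex.Re (d i)).
  rewrite -kE; apply: singular_values_sorted; case: n kn {M x s1 tM d c dev c0 E i kE} => //= n kn.
  by rewrite leqnn andbT -ltnS.
(* Num.sqrt is 0 on negative numbers, so a value of at least 1 rules them out. *)
move=> /(le_trans s1).
have [d0|d0] := ltP 0 (complex.Re (d i)); last by rewrite ler0_sqrtr // ler10.
by rewrite -{1}sqrtr1 ler_sqrt // ltW.
Qed.

Definition bf n (P : 'M[R]_n) (x y : 'cV[R]_n) : R := (x^T *m P *m y) 0 0.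

Lemma qfDl n (P P' : 'M[R]_n) x : qf (P + P') x = qf P x + qf P' x.
Proof. by rewrite /qf mulmxDr mulmxDl mxE. Qed.

Lemma qfZ n a (P : 'M[R]_n) x : qf (a *: P) x = a * qf P x.
Proof. by rewrite /qf -scalemxAr -scalemxAl mxE. Qed.

Lemma qf0 n (x : 'cV[R]_n) : qf 0 x = 0.
Proof. by rewrite /qf mulmx0 mul0mx mxE. Qed.

Lemma bfC n (P : 'M[R]_n) x y : P^T = P -> bf P x y = bf P y x.
Proof.
move=> symP; rewrite /bf -[x^T *m P *m y]trmxK mxE.
by rewrite !trmx_mul trmxK symP mulmxA.
Qed.

Lemma qfD n (P : 'M[R]_n) x y : P^T = P ->
  qf P (x + y) = qf P x + 2 * bf P x y + qf P y.
Proof.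
move=> symP; have add00 (M N : 'M[R]_1) : (M + N) 0 0 = M 0 0 + N 0 0 by rewrite mxE.
rewrite {1}/qf [(x + y)^T]linearD /= !mulmxDl !mulmxDr !add00.
rewrite -/(qf P x) -/(qf P y) -/(bf P x y) -/(bf P y x) (bfC y x symP).
by rewrite mulr2n mulrDl mul1r !addrA.
Qed.

Lemma qfZr n (P : 'M[R]_n) a x : qf P (a *: x) = a ^+ 2 * qf P x.
Proof.
have scale00 (b : R) (M : 'M[R]_1) : (b *: M) 0 0 = b * M 0 0 by rewrite mxE.
by rewrite /qf [(a *: x)^T]linearZ /= -!scalemxAl -scalemxAr !scale00 mulrA expr2.
Qed.

Lemma bfZr n (P : 'M[R]_n) a x y : bf P x (a *: y) = a * bf P x y.
Proof. by rewrite /bf -scalemxAr mxE. Qed.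

(** Expand the nonnegative value of the form at a x - y. *)
Lemma bf_young n (P : 'M[R]_n) x y a : psd P -> 0 < a ->
  2 * bf P x y <= a * qf P x + a^-1 * qf P y.
Proof.
move=> [symP P0] a0; have := P0 (a *: x + (-1) *: y); rewrite -/(qf P _).
rewrite qfD // !qfZr bfZr /bf linearZ /= -!scalemxAl mxE -/(bf P x y).
rewrite sqrrN expr1n mul1r => h.
rewrite -(ler_pM2l a0) mulrDr mulrA mulVKf ?gt_eqF //.
nra.
Qed.

Lemma qfD_young n (P : 'M[R]_n) x y a : psd P -> 0 < a ->
  qf P (x + y) <= (1 + a) * qf P x + (1 + a^-1) * qf P y.
Proof.
move=> hP a0; rewrite qfD; last by case: hP.
by have := bf_young x y hP a0; lra.
Qed.

Lemma sqnD n (x y : 'cV[R]_n) : sqn (x + y) <= 2 * sqn x + 2 * sqn y.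
Proof.
rewrite !sqnE !mulr_sumr -big_split /=; apply: ler_sum => i _; rewrite mxE.
by have := sqr_ge0 (x i 0 - y i 0); nra.
Qed.

(** Young's inequality between x and P x turns a bound on the norm of P x into one
on the form of P. *)
Lemma qf_le_sqn n (P : 'M[R]_n) g x : 0 < g ->
  sqn (P *m x) <= g ^+ 2 * sqn x -> qf P x <= g * sqn x.
Proof.
move=> g0 h.
have psd1 : psd (1%:M : 'M[R]_n).
  by split=> [|y]; rewrite ?trmx1 // -/(qf _ _) qf_id sqn_ge0.
have := bf_young x (P *m x) psd1 g0.
rewrite !qf_id /bf mulmx1 mulmxA -/(qf P x) => h2.
have h3 : g^-1 * sqn (P *m x) <= g * sqn x.
  by rewrite -(ler_pM2l g0) mulVKf ?gt_eqF // mulrA -expr2.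
by lra.
Qed.

Lemma qf_le_specnorm n (P : 'M[R]_n) g x : 0 < g -> specnorm P <= g ->
  qf P x <= g * sqn x.
Proof.
move=> g0 Pg; apply: qf_le_sqn => //; apply: le_trans (specnorm_bound P x) _.
by apply: ler_wpM2r; rewrite ?sqn_ge0 // lerXn2r // nnegrE ?specnorm_ge0 // ltW.
Qed.

(** Singular values only control the norm of P x, not its form. For P y = x they
give |y| <= |x|; Young's inequality for P between x and y then bounds |x|^2 = x^T P y
by half the form at x plus half of |x|^2. *)
Lemma psd_sigma_ge1 n (P : 'M[R]_n) x : psd P -> 1 <= sigma n P ->
  sqn x <= qf P x.
Proof.
move=> hP s1.
have ex y : sqn y <= sqn (P *m y) by exact: sigma_min_bound.
have Pu : P \in unitmx.
  apply: inj_unitmx => y Py0; apply: sqn_eq0; apply/eqP.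
  by rewrite eq_le sqn_ge0 andbT (le_trans (ex y)) // Py0 /sqn mulmx0 mxE.
pose y := invmx P *m x; have yx : P *m y = x by rewrite mulKVmx.
have := bf_young x y hP ltr01; rewrite invr1 !mul1r.
have -> : bf P x y = sqn x by rewrite /bf -mulmxA yx.
have : qf P y <= sqn x.
  have := ex y; rewrite yx => h.
  have psd1 : psd (1%:M : 'M[R]_n).
    by split=> [|z]; rewrite ?trmx1 // -/(qf _ _) qf_id sqn_ge0.
  have := bf_young y x psd1 ltr01; rewrite invr1 !mul1r !qf_id.
  rewrite /bf mulmx1 -{1}yx mulmxA -/(qf P y); lra.
lra.
Qed.

End Quadratic.

(** * Entrywise limits of matrices *)

Section MatrixLimits.
Local Open Scope classical_set_scope.
Context {R : realType}.

(** Limits are taken entry by entry, so that products, determinants and inverses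
converge because ring operations are continuous. *)
Definition mcvg m n (u : nat -> 'M[R]_(m, n)) (l : 'M[R]_(m, n)) : Prop :=
  forall i j, u k i j @[k --> \oo] --> l i j.

Lemma mcvg_cst m n (M : 'M[R]_(m, n)) : mcvg (fun=> M) M.
Proof. by move=> i j; exact: cvg_cst. Qed.

Lemma mcvgD m n (u v : nat -> 'M[R]_(m, n)) a b :
  mcvg u a -> mcvg v b -> mcvg (fun k => u k + v k) (a + b).
Proof.
move=> ua vb i j; rewrite mxE; under eq_fun do rewrite mxE.
by apply: cvgD; [exact: ua|exact: vb].
Qed.

Lemma mcvgN m n (u : nat -> 'M[R]_(m, n)) a :
  mcvg u a -> mcvg (fun k => - u k) (- a).
Proof.
by move=> ua i j; rewrite mxE; under eq_fun do rewrite mxE; apply: cvgN.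
Qed.

Lemma mcvg_tr m n (u : nat -> 'M[R]_(m, n)) a :
  mcvg u a -> mcvg (fun k => (u k)^T) a^T.
Proof. by move=> ua i j; rewrite mxE; under eq_fun do rewrite mxE; apply: ua. Qed.

Lemma mcvgM m n l (u : nat -> 'M[R]_(m, n)) (v : nat -> 'M[R]_(n, l)) a b :
  mcvg u a -> mcvg v b -> mcvg (fun k => u k *m v k) (a *m b).
Proof.
move=> ua vb i j; rewrite mxE; under eq_fun do rewrite mxE.
apply: cvg_big => [|k _]; first exact: add_continuous.
by apply: cvgM; [exact: ua|exact: vb].
Qed.

Lemma cvg_det n (u : nat -> 'M[R]_n) a : mcvg u a -> \det (u k) @[k --> \oo] --> \det a.
Proof.
move=> ua; apply: cvg_big => [|s _]; first exact: add_continuous.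
apply: cvgM; first exact: cvg_cst.
by apply: cvg_big => [|i _]; [exact: mul_continuous|exact: ua].
Qed.

Lemma mcvg_inv n (u : nat -> 'M[R]_n) a :
  (forall k, u k \in unitmx) -> a \in unitmx -> mcvg u a ->
  mcvg (fun k => invmx (u k)) (invmx a).
Proof.
move=> uu au ua i j; rewrite /invmx au !mxE; under eq_fun do rewrite uu !mxE.
apply: cvgM.
  by apply: cvgV; [rewrite -unitfE -unitmxE | exact: cvg_det].
apply: cvgM; first exact: cvg_cst.
by apply: cvg_det => k l; rewrite !mxE; under eq_fun do rewrite !mxE; exact: ua.
Qed.

Lemma mcvg_unique m n (u : nat -> 'M[R]_(m, n)) a b :
  mcvg u a -> mcvg u b -> a = b.
Proof.
by move=> ua ub; apply/matrixP => i j; apply: (cvg_unique _ (ua i j) (ub i j)).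
Qed.

Lemma mcvgS m n (u : nat -> 'M[R]_(m, n)) a :
  mcvg u a -> mcvg (fun k => u k.+1) a.
Proof. by move=> ua i j; rewrite (cvg_shiftS (fun k => u k i j)); exact: ua. Qed.

Lemma mcvg_qf n (u : nat -> 'M[R]_n) a x :
  mcvg u a -> qf (u k) x @[k --> \oo] --> qf a x.
Proof.
by move=> ua; exact: (mcvgM (mcvgM (@mcvg_cst _ _ x^T) ua) (@mcvg_cst _ _ x)).
Qed.

Lemma mx_entry_qf n (P : 'M[R]_n) i j : P^T = P ->
  let ei := delta_mx i 0 in let ej := delta_mx j 0 in
  P i j = 2^-1 * (qf P (ei + ej) - qf P ei - qf P ej).
Proof.
move=> symP ei ej; rewrite qfD //.
have -> : bf P ei ej = P i j.
  by rewrite /bf trmx_delta -rowE -colE !mxE.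
by field.
Qed.

(** By polarization the entries are combinations of values of the form, each of
which is a bounded monotone sequence. *)
Lemma mcvg_nondecreasing n (u : nat -> 'M[R]_n) (b : 'cV[R]_n -> R) :
  (forall k, (u k)^T = u k) ->
  (forall k x, qf (u k) x <= qf (u k.+1) x) ->
  (forall k x, qf (u k) x <= b x) ->
  exists a, mcvg u a.
Proof.
move=> usym unondec ub.
have qcvg x : exists l : R, qf (u k) x @[k --> \oo] --> l.
  apply/cvg_ex; apply: nondecreasing_is_cvgn.
    by apply/nondecreasing_seqP => k; exact: unondec.
  by exists (b x) => _ [k _ <-]; exact: ub.
have [l lE] := choice qcvg.
exists (\matrix_(i, j) (2^-1 * (l (delta_mx i 0 + delta_mx j 0) - l (delta_mx i 0)
                                - l (delta_mx j 0)))).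
move=> i j; rewrite mxE; under eq_fun do rewrite mx_entry_qf //.
by apply: cvgM; [exact: cvg_cst|apply: cvgB => //; apply: cvgB].
Qed.

Lemma psd_mcvg n (u : nat -> 'M[R]_n) a :
  (forall k, psd (u k)) -> mcvg u a -> psd a.
Proof.
move=> up ua; split.
  apply: (mcvg_unique (mcvg_tr ua)) => i j.
  under eq_fun do rewrite (up _).1; exact: ua.
move=> x; rewrite -/(qf a x); have qa := @mcvg_qf _ u a x ua.
rewrite -(cvg_lim _ qa) //; apply: limr_ge; first by apply/cvg_ex; exists (qf a x).
by apply: nearW => k; exact: (up k).2.
Qed.

End MatrixLimits.

(** * Riccati recursions over a family of spaces *)

Section Families.
Local Open Scope classical_set_scope.
Context {R : realType} {T : Type} (N : pred T) (nx : T -> T) (d e : T -> nat).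
Hypothesis nxN : forall r, N r -> N (nx r).
Context (A : forall r, 'M[R]_(d (nx r), d r)) (B : forall r, 'M[R]_(d (nx r), e r)).
Context (Q : forall r, 'M[R]_(d r)) (U : forall r, 'M[R]_(e r)).
Implicit Types (P X : forall r, 'M[R]_(d r)) (K : forall r, 'M[R]_(e r, d r)).

(** The recursions of the control problem, for state and input spaces that depend on
an index r with successor nx r. Zero-dimensional input spaces are allowed, and make
a Lyapunov equation an instance of a Riccati equation. *)
Definition fcl K r : 'M[R]_(d (nx r), d r) := A r + B r *m K r.

Definition fgain P : forall r, 'M[R]_(e r, d r) := fun r =>
  - (invmx (U r + (B r)^T *m P (nx r) *m B r)
       *m (B r)^T *m P (nx r) *m A r).

Definition fstep K P : forall r, 'M[R]_(d r) := fun r =>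
  Q r + (K r)^T *m U r *m K r + (fcl K r)^T *m P (nx r) *m fcl K r.

Definition fstage K r : 'M[R]_(d r) := Q r + (K r)^T *m U r *m K r.

Lemma qf_fstep K P r x :
  qf (fstep K P r) x = qf (fstage K r) x + qf (P (nx r)) (fcl K r *m x).
Proof. by rewrite /fstep qfDl qf_congr. Qed.

Lemma qf_fstage K r x : qf (fstage K r) x = qf (Q r) x + qf (U r) (K r *m x).
Proof. by rewrite /fstage qfDl qf_congr. Qed.

Lemma sym_congr m n (M : 'M[R]_m) (L : 'M[R]_(m, n)) :
  M^T = M -> (L^T *m M *m L)^T = L^T *m M *m L.
Proof. by move=> symM; rewrite !trmx_mul trmxK symM mulmxA. Qed.

Lemma psd_congr m n (M : 'M[R]_m) (L : 'M[R]_(m, n)) :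
  psd M -> psd (L^T *m M *m L).
Proof.
move=> [symM M0]; split; first exact: sym_congr.
by move=> x; rewrite -/(qf _ x) qf_congr; exact: M0.
Qed.

Lemma psdD n (M M' : 'M[R]_n) : psd M -> psd M' -> psd (M + M').
Proof.
move=> [sM M0] [sM' M0']; split; first by rewrite linearD /= sM sM'.
by move=> x; rewrite -/(qf _ x) qfDl addr_ge0 //; [exact: M0|exact: M0'].
Qed.

Lemma pd_psd n (M : 'M[R]_n) : pd M -> psd M.
Proof.
move=> [sM M0]; split=> // x; have [->|/M0/ltW//] := eqVneq x 0.
by rewrite trmx0 mul0mx mul0mx mxE.
Qed.

Lemma pd_unitmx n (M : 'M[R]_n) : pd M -> M \in unitmx.
Proof.
move=> [_ M0]; apply: inj_unitmx => x Mx0; apply/eqP; apply/negP => /negP /M0.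
by rewrite -mulmxA Mx0 mulmx0 mxE ltxx.
Qed.

Lemma pdD_psd n (M M' : 'M[R]_n) : pd M -> psd M' -> pd (M + M').
Proof.
move=> [sM M0] [sM' M0']; split; first by rewrite linearD /= sM sM'.
move=> x x0; rewrite -/(qf _ x) qfDl ltr_wpDr //; [exact: M0'|exact: M0].
Qed.

Section OneStep.
Variables (P : forall r, 'M[R]_(d r)) (r : T).
Hypotheses (hU : pd (U r)) (hP : psd (P (nx r))).
Let S := U r + (B r)^T *m P (nx r) *m B r.

Let pdS : pd S.
Proof. by apply: pdD_psd => //; exact: psd_congr. Qed.

(** Completing the square in the input: the cost of any gain exceeds that of the
optimal one by a form in the difference of the two inputs. *)
Lemma fstep_gain K x :
  qf (fstep K P r) x =
  qf (fstep (fgain P) P r) x + qf S (K r *m x - fgain P r *m x).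
Proof.
have [symS _] := pdS; have [symP _] := hP.
have val (k : 'cV[R]_(e r)) : qf (U r) k + qf (P (nx r)) (A r *m x + B r *m k) =
    qf S k + 2 * bf (P (nx r)) (A r *m x) (B r *m k) + qf (P (nx r)) (A r *m x).
  by rewrite qfD // /S qfDl qf_congr; ring.
rewrite !qf_fstep !qf_fstage /fcl !mulmxDl -!mulmxA -!addrA !val -!addrA.
congr (_ + _); set k := K r *m x; set k0 := fgain P r *m x.
have Sk0 : S *m k0 = - ((B r)^T *m P (nx r) *m (A r *m x)).
  rewrite /k0 /fgain mulNmx mulmxN -/S -!mulmxA.
  by rewrite (mulKVmx (pd_unitmx pdS)) !mulmxA.
have cross z : bf S z k0 = - bf (P (nx r)) (A r *m x) (B r *m z).
  rewrite bfC // [in RHS]bfC // /bf -[in LHS](trmxK S) symS -trmx_mul Sk0.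
  rewrite linearN /= mulNmx mxE !trmx_mul trmxK symP !mulmxA.
  rewrite -[(x^T *m _ *m _ *m _ *m z)]trmxK mxE.
  by rewrite !trmx_mul !trmxK symP !mulmxA.
have -> : qf S k = qf S (k0 + (k - k0)) by rewrite addrC subrK.
rewrite [qf S (k0 + _)]qfD // [bf S k0 _]bfC // cross.
have -> : bf (P (nx r)) (A r *m x) (B r *m (k - k0)) =
   bf (P (nx r)) (A r *m x) (B r *m k) - bf (P (nx r)) (A r *m x) (B r *m k0).
  by rewrite mulmxBr /bf mulmxBr mxE [in X in _ + X = _]mxE.
by rewrite [RHS]addrA val; ring.
Qed.

Lemma fstep_gain_le K x : qf (fstep (fgain P) P r) x <= qf (fstep K P r) x.
Proof. by rewrite (fstep_gain K) lerDl (pd_psd pdS).2. Qed.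

End OneStep.

Lemma fstep_le K P P' r :
  (forall x, qf (P (nx r)) x <= qf (P' (nx r)) x) ->
  forall x, qf (fstep K P r) x <= qf (fstep K P' r) x.
Proof. by move=> PP' x; rewrite !qf_fstep lerD2l. Qed.

Lemma psd_fstep K P r : psd (Q r) -> psd (U r) -> psd (P (nx r)) -> psd (fstep K P r).
Proof. by move=> *; do 2?apply: psdD => //; exact: psd_congr. Qed.

Section Existence.
Hypotheses (hQ : forall r, N r -> psd (Q r)) (hU : forall r, N r -> pd (U r)).
Variables (S : forall r, 'M[R]_(d r)) (K0 : forall r, 'M[R]_(e r, d r)).
Hypothesis hS0 : forall r, N r -> forall x, 0 <= qf (S r) x.
Hypothesis hS : forall r, N r -> forall x, qf (fstep K0 S r) x <= qf (S r) x.

Fixpoint value_iter k : forall r, 'M[R]_(d r) :=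
  if k is k'.+1 then fstep (fgain (value_iter k')) (value_iter k') else fun=> 0.

Lemma psd0 n : psd (0 : 'M[R]_n).
Proof. by split=> [|x]; rewrite ?trmx0 // -/(qf 0 x) qf0. Qed.

Lemma value_iter_psd k r : N r -> psd (value_iter k r).
Proof.
elim: k r => [|k IH] r Nr /=; first exact: psd0.
by apply: psd_fstep; [exact: hQ|exact/pd_psd/hU|exact/IH/nxN].
Qed.

Lemma value_iter_nondecreasing k r : N r ->
  forall x, qf (value_iter k r) x <= qf (value_iter k.+1 r) x.
Proof.
elim: k r => [|k IH] r Nr x.
  by rewrite [value_iter 0 r]/= qf0; exact: (value_iter_psd 1 Nr).2.
apply: le_trans (fstep_gain_le (hU Nr) _ (fgain (value_iter k.+1)) x) _.
  exact/value_iter_psd/nxN.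
by apply: fstep_le => y; exact/IH/nxN.
Qed.

Lemma value_iter_bound k r : N r -> forall x, qf (value_iter k r) x <= qf (S r) x.
Proof.
elim: k r => [|k IH] r Nr x /=; first by rewrite qf0; exact: hS0.
apply: le_trans (fstep_gain_le (hU Nr) _ K0 x) _.
  exact/value_iter_psd/nxN.
by apply: le_trans (hS Nr x); apply: fstep_le => y; exact/IH/nxN.
Qed.

(** Value iteration converges because it increases and stays below the
supersolution S; the limit is a fixed point because one step is continuous, positive
definiteness of U keeping the inverse in the gain away from singularities. *)
Lemma riccati_exists : exists P,
  forall r, N r -> psd (P r) /\ P r = fstep (fgain P) P r.
Proof.
have lim r : exists a, N r -> mcvg (fun k => value_iter k r) a.
  have [Nr|] := boolP (N r); last by exists 0.
  have [a ha] := mcvg_nondecreasing (fun k => (value_iter_psd k Nr).1)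
    (fun k => @value_iter_nondecreasing k r Nr) (fun k => @value_iter_bound k r Nr).
  by exists a.
pose P r := projT1 (cid (lim r)).
have Pc r (Nr : N r) : mcvg (fun k => value_iter k r) (P r).
  by rewrite /P; case: cid => a /= /(_ Nr).
have Ppsd r (Nr : N r) : psd (P r).
  by apply: psd_mcvg (Pc r Nr) => k; exact: value_iter_psd.
exists P => r Nr; split; first exact: Ppsd.
have cn := Pc _ (nxN Nr).
have Bc := @mcvg_cst R _ _ (B r)^T; have Bc' := @mcvg_cst R _ _ (B r).
have Ac := @mcvg_cst R _ _ (A r).
have unitS M : psd M -> U r + (B r)^T *m M *m B r \in unitmx.
  by move=> hM; apply/pd_unitmx/pdD_psd; [exact: hU|exact: psd_congr].
have gc : mcvg (fun k => fgain (value_iter k) r) (fgain P r).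
  apply: mcvgN; apply: (mcvgM _ Ac); apply: (mcvgM _ cn); apply: (mcvgM _ Bc).
  apply: mcvg_inv => [k||]; try by apply: unitS; do ?[exact: value_iter_psd (nxN Nr)|exact/Ppsd/nxN].
  by apply: (mcvgD _ (mcvgM (mcvgM Bc cn) Bc')); exact: mcvg_cst.
have clc : mcvg (fun k => fcl (fgain (value_iter k)) r) (fcl (fgain P) r).
  by apply: mcvgD => //; exact: mcvgM.
apply: (mcvg_unique (mcvgS (Pc r Nr))) => /=.
apply: (mcvgD _ (mcvgM (mcvgM (mcvg_tr clc) cn) clc)).
by apply: mcvgD; [exact: mcvg_cst|apply: (mcvgM _ gc); apply: (mcvgM (mcvg_tr gc)); exact: mcvg_cst].
Qed.

End Existence.
End Families.

(** * Comparison of costs under perturbed dynamics *)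

Lemma qf_abs_bound {R : realType} n (X : 'M[R]_n) :
  exists2 c : R, 0 <= c & forall x, `|qf X x| <= c * sqn x.
Proof.
exists (\sum_i \sum_j `|X i j|) => [|x].
  by apply: sumr_ge0 => i _; apply: sumr_ge0.
have -> : qf X x = \sum_i \sum_j x j 0 * X j i * x i 0.
  rewrite /qf mxE; apply: eq_bigr => i _; rewrite mxE mulr_suml.
  by apply: eq_bigr => j _; rewrite mxE.
rewrite exchange_big /= mulr_suml; apply: le_trans (ler_norm_sum _ _ _) _.
apply: ler_sum => i _; rewrite mulr_suml; apply: le_trans (ler_norm_sum _ _ _) _.
apply: ler_sum => j _; rewrite !normrM mulrAC mulrC mulrA.
rewrite -mulrA ler_wpM2l //.
have sq k : `|x k 0| ^+ 2 <= sqn x.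
  rewrite sqnE (bigD1 k) //= real_normK ?num_real // lerDl.
  by apply: sumr_ge0 => l _; exact: sqr_ge0.
have := sq i; have := sq j.
by have := sqr_ge0 (`|x i 0| - `|x j 0|); nra.
Qed.

Section Comparison.
Local Open Scope classical_set_scope.
Context {R : realType} {T : finType} (N : pred T) (nx : T -> T) (d : T -> nat).
Hypothesis nxN : forall r, N r -> N (nx r).
Implicit Types (P X M : forall r, 'M[R]_(d r)) (L : forall r, 'M[R]_(d (nx r), d r)).

Lemma family_abs_bound X : exists2 c : R, 0 <= c &
  forall r x, `|qf (X r) x| <= c * sqn x.
Proof.
have [c c0 hc] : exists2 c : T -> R, forall r, 0 <= c r &
    forall r x, `|qf (X r) x| <= c r * sqn x.
  have /choice[c hc] : forall r, exists c : R, 0 <= c /\ forall x, `|qf (X r) x| <= c * sqn x.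
    by move=> r; have [c] := qf_abs_bound (X r); exists c.
  by exists c => r; case: (hc r).
exists (\sum_r c r) => [|r x]; first exact: sumr_ge0.
apply: le_trans (hc r x) _; apply: ler_wpM2r; first exact: sqn_ge0.
by rewrite (bigD1 r) //= lerDl sumr_ge0.
Qed.

(** Iterate the first inequality k times along L: f is at most c rho^k h, which
tends to 0. *)
Lemma subinvariant_le0 L (f h : forall r, 'cV[R]_(d r) -> R) (c rho : R) :
  0 <= c -> 0 <= rho < 1 ->
  (forall r, N r -> forall x, f r x <= f (nx r) (L r *m x)) ->
  (forall r, N r -> forall x, f r x <= c * h r x) ->
  (forall r, N r -> forall x, h (nx r) (L r *m x) <= rho * h r x) ->
  forall r, N r -> forall x, f r x <= 0.
Proof.
move=> c0 /andP[rho0 rho1] fL fh hL.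
have pow k r : N r -> forall x, f r x <= c * rho ^+ k * h r x.
  elim: k r => [|k IH] r Nr x; first by rewrite mulr1; exact: fh.
  apply: le_trans (fL r Nr x) _; apply: le_trans (IH _ (nxN Nr) _) _.
  rewrite exprSr mulrA -[leRHS]mulrA; apply: ler_wpM2l; last exact: hL.
  by rewrite mulr_ge0 ?exprn_ge0.
move=> r Nr x.
have cv : c * rho ^+ k * h r x @[k --> \oo] --> (0 : R).
  rewrite -[X in _ --> X](mul0r (h r x)); apply: cvgMl.
  rewrite -[X in _ --> X](mulr0 c); apply: cvgMr.
  by apply: cvg_expr; rewrite ger0_norm.
rewrite -(cvg_lim _ cv) //; apply: limr_ge; first by apply/cvg_ex; exists (0 : R).
by apply: nearW => k; exact: pow.
Qed.

Section Perturbed.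
Variables (M P : forall r, 'M[R]_(d r)) (L L' : forall r, 'M[R]_(d (nx r), d r)).
Variables (g dl : R).
Hypotheses (g1 : 1 <= g) (dl0 : 0 < dl <= 1) (gdl : 3 * g * dl < 1).
Hypothesis hM : forall r, N r -> forall x, sqn x <= qf (M r) x.
Hypothesis hP : forall r, N r -> psd (P r).
Hypothesis PE : forall r, N r -> forall x,
  qf (P r) x = qf (M r) x + qf (P (nx r)) (L r *m x).
Hypothesis Pg : forall r, N r -> forall x, qf (P r) x <= g * sqn x.
Hypothesis LL' : forall r, N r -> forall x,
  sqn ((L' r - L r) *m x) <= dl ^+ 2 * sqn x.

(** Split L' x as L x + (L' - L) x by Young's inequality with weight dl. The
three resulting error terms are each at most g dl |x|^2, and the stage cost absorbs
them because it is at least |x|^2. *)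
Lemma perturbed_supersolution r : N r -> forall x,
  (1 - 3 * g * dl) * qf (M r) x + qf (P (nx r)) (L' r *m x) <= qf (P r) x.
Proof.
move=> Nr x; have /andP[dlp dl1] := dl0.
have -> : L' r *m x = L r *m x + (L' r - L r) *m x by rewrite mulmxBl addrC subrK.
have := qfD_young (L r *m x) ((L' r - L r) *m x) (hP (nxN Nr)) dlp.
move: (qf _ (_ + _)) => a ha; have g0 : 0 <= g by apply: le_trans g1.
have h1 : qf (P (nx r)) ((L' r - L r) *m x) <= g * (dl ^+ 2 * sqn x).
  apply: le_trans (Pg (nxN Nr) _) _; apply: ler_wpM2l => //.
  exact: LL'.
have h2 : (1 + dl^-1) * qf (P (nx r)) ((L' r - L r) *m x) <= g * (dl ^+ 2 + dl) * sqn x.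
  have -> : g * (dl ^+ 2 + dl) * sqn x = (1 + dl^-1) * (g * (dl ^+ 2 * sqn x)).
    by field; rewrite gt_eqF.
  by apply: ler_wpM2l => //; rewrite addr_ge0 // invr_ge0 ltW.
have PEx := PE Nr x; have Pgx := Pg Nr x; have Mx := hM Nr x; have s0 := sqn_ge0 x.
have h3 : qf (P (nx r)) (L r *m x) <= g * sqn x by lra.
have h4 : dl * qf (P (nx r)) (L r *m x) <= dl * (g * sqn x) by rewrite ler_pM2l.
have h5 : g * (dl ^+ 2 + dl) * sqn x <= 2 * g * dl * sqn x.
  apply: ler_wpM2r => //.
  have : dl ^+ 2 <= dl by rewrite expr2 ler_piMl // ltW.
  by move=> h; nra.
have h6 : 3 * g * dl * sqn x <= 3 * g * dl * qf (M r) x.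
  by apply: ler_wpM2l => //; rewrite !mulr_ge0 // ltW.
by lra.
Qed.

Definition rate : R := 1 - (1 - 3 * g * dl) / g.

Lemma rate_bounds : 0 <= rate < 1.
Proof.
rewrite /rate; have g0 : 0 < g by exact: lt_le_trans ltr01 g1.
have /andP[dlp dl1] := dl0; apply/andP; split; last first.
  by rewrite ltrBlDr ltrDl divr_gt0 // subr_gt0.
rewrite subr_ge0 ler_pdivrMr // mul1r.
by apply: le_trans g1; rewrite gerBl !mulr_ge0 // ltW.
Qed.

(** The stage cost is at least |x|^2, hence at least the fraction 1/g of the
cost-to-go, and each step spends the share 1 - 3 g dl of it. *)
Lemma perturbed_contraction r : N r -> forall x,
  qf (P (nx r)) (L' r *m x) <= rate * qf (P r) x.
Proof.
move=> Nr x; have := perturbed_supersolution Nr x; have g0 : 0 < g by exact: lt_le_trans ltr01 g1.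
have Pgx := Pg Nr x; have Mx := hM Nr x.
have : (1 - 3 * g * dl) / g * qf (P r) x <= (1 - 3 * g * dl) * qf (M r) x.
  rewrite -mulrA ler_wpM2l //; first by rewrite subr_ge0 ltW.
  by rewrite ler_pdivrMl // (le_trans Pgx) // ler_pM2l.
by rewrite /rate; lra.
Qed.

(** X is a subsolution and P / (1 - 3 g dl) a supersolution of the same linear
recursion, so their difference is subinvariant. *)
Lemma perturbed_compare X :
  (forall r, N r -> forall x, qf (X r) x <= qf (M r) x + qf (X (nx r)) (L' r *m x)) ->
  forall r, N r -> forall x, (1 - 3 * g * dl) * qf (X r) x <= qf (P r) x.
Proof.
move=> hX r Nr x; rewrite -subr_le0.
have [c c0 cX] := family_abs_bound X.
have eta0 : 0 < 1 - 3 * g * dl by rewrite subr_gt0.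
apply: (@subinvariant_le0 L' (fun r x => (1 - 3 * g * dl) * qf (X r) x - qf (P r) x)
  (fun r => qf (P r)) ((1 - 3 * g * dl) * c) rate) => //; first 1 last.
- exact: rate_bounds.
- move=> s Ns y; have := perturbed_supersolution Ns y.
  have : (1 - 3 * g * dl) * qf (X s) y <=
    (1 - 3 * g * dl) * (qf (M s) y + qf (X (nx s)) (L' s *m y)).
    by rewrite ler_pM2l // hX.
  by lra.
- move=> s Ns y; have P0 : 0 <= qf (P s) y by exact: (hP Ns).2.
  rewrite lerBlDr -(mulrA _ c); apply: le_trans (_ : (1 - 3 * g * dl) * (c * qf (P s) y) <= _).
    rewrite ler_pM2l // (le_trans (ler_norm _)) // (le_trans (cX s y)) //.
    apply: ler_wpM2l => //; rewrite PE //; apply: le_trans (hM Ns y) _.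
    by rewrite lerDl; exact: (hP (nxN Ns)).2.
  by rewrite lerDl.
- exact: perturbed_contraction.
- by rewrite mulr_ge0 // ltW.
Qed.

End Perturbed.
End Comparison.

(** * The information graph *)

Section InfoGraph.
Context {p : nat} (G : delay_graph p).

Lemma D_leP i j k : reflect
  (exists s, [/\ path (edge G) j s, last j s = i & (walk_delay G j s <= k)%N])
  (D_le G i j k).
Proof.
rewrite /D_le /D; case: pselect => [h|nh] /=; last first.
  constructor=> -[s [ps ls _]]; apply: nh; exists (walk_delay G j s).
  by apply/asboolP; exists s.
case: ex_minnP => d dw dmin; apply: (iffP idP) => [dk|].
  by have /asboolP[s [ps ls sd]] := dw; exists s; rewrite sd.
move=> [s' [ps' ls' s'k]]; apply: leq_trans s'k; apply: dmin.
by apply/asboolP; exists s'.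
Qed.

Lemma D_le_refl i k : D_le G i i k.
Proof. by apply/D_leP; exists [::]. Qed.

Lemma walk_delay_cat x s t :
  walk_delay G x (s ++ t) = (walk_delay G x s + walk_delay G (last x s) t)%N.
Proof. by elim: s x => //= y s IH x; rewrite IH addnA. Qed.

Lemma D_le_trans i j l a b : D_le G i j a -> D_le G l i b -> D_le G l j (a + b).
Proof.
move=> /D_leP[s [ps ls sa]] /D_leP[t [pt lt tb]]; apply/D_leP; exists (s ++ t).
by rewrite cat_path last_cat walk_delay_cat ls ps pt lt leq_add.
Qed.

Hypothesis hG : delay_graph_wf G.

(** Edges have delay 0 or 1, so the delay grows by unit steps along a walk. A walk of
total delay k + 1 can be cut where the delay is k, leaving a rest of delay 1. *)
Lemma D_leS i j k :
  D_le G i j k.+1 <-> exists2 l, D_le G l j k & D_le G i l 1.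
Proof.
split=> [/D_leP[s [ps <- sk]]|[l lj il]]; last by rewrite -addn1; exact: D_le_trans il.
elim/last_ind: s ps sk => [|s y IH]; first by exists j; exact: D_le_refl.
rewrite rcons_path last_rcons -cats1 walk_delay_cat /= addn0 => /andP[ps sy] sk.
have one d : (delay G (last j s) y <= d)%N -> D_le G y (last j s) d.
  by move=> h; apply/D_leP; exists [:: y]; rewrite /= sy addn0.
have [sk'|] := leqP (walk_delay G j s) k.
  exists (last j s); first by apply/D_leP; exists s.
  by apply: one; case: hG => _ + _; apply.
rewrite -ltnS => ks; have [|l lj ls] := IH ps.
  exact: leq_trans (leq_addr _ _) sk.
exists l => //; rewrite -[1%N]addn0; apply: D_le_trans ls (one _ _).
by rewrite -(leq_add2l (walk_delay G j s)) addn0 (leq_trans sk).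
Qed.

Lemma mem_info i j k : (i \in info G j k) = D_le G i j k.
Proof. by rewrite inE. Qed.

Lemma info_self j : j \in info G j 0.
Proof. by rewrite mem_info D_le_refl. Qed.

Lemma nodesP r : reflect (exists j k, r = info G j k) (r \in nodes G).
Proof. by rewrite inE; exact: asboolP. Qed.

Lemma info_nodes j k : info G j k \in nodes G.
Proof. by apply/nodesP; exists j, k. Qed.

(** Makes the successor of a node well defined: the set at the next delay
depends on the current set alone, not on its representation by j and k. *)
Lemma info_step j k j' k' :
  info G j k = info G j' k' -> info G j k.+1 = info G j' k'.+1.
Proof.
move=> E; apply/setP => i; rewrite !mem_info.
by apply/idP/idP => /D_leS[l lj il]; apply/D_leS; exists l => //;
  move: lj; rewrite -!mem_info E.
Qed.

Lemma info_edgeE r s : info_edge G r s = (r \in nodes G) && (s == succ G r).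
Proof.
apply/idP/andP => [h|[/nodesP[j [k rE]] /eqP sE]].
  have /asboolP[j [k [rE sE]]] := h; split; first by rewrite rE info_nodes.
  rewrite /succ; case: pickP => [s' /asboolP[j' [k' [rE' ->]]]|/(_ s)]; last by rewrite h.
  by apply/eqP; rewrite sE; apply: info_step; rewrite -rE.
rewrite sE /succ; case: pickP => [//|/(_ (info G j k.+1))] /negP[].
by apply/asboolP; exists j, k.
Qed.

Lemma succ_info j k : succ G (info G j k) = info G j k.+1.
Proof.
have : info_edge G (info G j k) (info G j k.+1) by apply/asboolP; exists j, k.
by rewrite info_edgeE => /andP[_ /eqP].
Qed.

Lemma succ_nodes r : r \in nodes G -> succ G r \in nodes G.
Proof. by move=> /nodesP[j [k ->]]; rewrite succ_info info_nodes. Qed.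

Lemma mem_succ r i j : r \in nodes G -> j \in r -> D_le G i j 1 -> i \in succ G r.
Proof.
move=> /nodesP[l [k ->]]; rewrite succ_info !mem_info => jl ij.
by apply/D_leS; exists j.
Qed.

(** All finite delays are at most Dmax, so the sets stop growing there. *)
Lemma info_root j k : (Dmax G <= k)%N -> info G j k \in roots G.
Proof.
move=> Dk; rewrite inE info_nodes info_edgeE info_nodes /= succ_info.
apply/eqP/setP => i; rewrite !mem_info /D_le.
case E : (D G i j) => [d|] //=.
have dk : (d <= k)%N.
  apply: leq_trans Dk; rewrite /Dmax (leq_trans _ (leq_bigmax i)) //.
  by rewrite (leq_trans _ (leq_bigmax j)) // E.
by rewrite dk (leq_trans dk).
Qed.

Lemma root_node s : s \in roots G -> s \in nodes G.
Proof. by rewrite inE => /andP[]. Qed.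

(** Induction from the roots to the leaves; it terminates because info j k is a root
once k reaches Dmax. *)
Lemma node_ind (C : {set 'I_p} -> Prop) :
  (forall s, s \in roots G -> C s) ->
  (forall r, r \in nodes G -> C (succ G r) -> C r) ->
  forall r, r \in nodes G -> C r.
Proof.
move=> Croot Cstep _ /nodesP[j [k ->]].
have [n] := ubnP (Dmax G - k); elim: n k => // n IH k kn.
have [/(info_root j)/Croot //|kD] := leqP (Dmax G) k.
apply: Cstep; first exact: info_nodes.
rewrite succ_info; apply: IH.
by rewrite -ltnS (leq_trans _ kn) // ltnS subnS prednK // subn_gt0.
Qed.

End InfoGraph.

(** * Restriction to blocks of coordinates *)

Section Blocks.
Context {R : realType} {p : nat} (a_ : 'I_p -> nat).
Implicit Types s r : {set 'I_p}.

(** With the restriction to coordinates as a matrix, every submatrix becomes a product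
and block identities follow from associativity. *)
Definition rst s : 'M[R]_(#|coords a_ s|, \sum_i a_ i) := rowsub enum_val 1%:M.

Lemma rstE s k l : rst s k l = (enum_val k == l)%:R.
Proof. by rewrite !mxE. Qed.

Lemma rst_mul n (M : 'M[R]_(\sum_i a_ i, n)) s : rst s *m M = rowsub enum_val M.
Proof. by rewrite mul_rowsub_mx mul1mx. Qed.

Lemma mul_rst_tr n (M : 'M[R]_(n, \sum_i a_ i)) s : M *m (rst s)^T = colsub enum_val M.
Proof. by apply: trmx_inj; rewrite trmx_mul trmxK rst_mul trmx_mxsub. Qed.

Lemma rst_rstT s : rst s *m (rst s)^T = 1%:M.
Proof.
apply/matrixP => k l; rewrite mul_rst_tr !mxE.
by rewrite (inj_eq enum_val_inj).
Qed.

Lemma rstT_rst s k l : ((rst s)^T *m rst s) k l = ((k == l) && (tagnat.sig1 k \in s))%:R.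
Proof.
rewrite mxE.
have [ks|kns] := boolP (tagnat.sig1 k \in s); last first.
  rewrite andbF big1 // => i _; rewrite mxE rstE.
  case: eqP => [ik|_]; last by rewrite mul0r.
  by have := enum_valP i; rewrite ik inE (negbTE kns).
have kC : k \in coords a_ s by rewrite inE.
rewrite andbT (bigD1 (enum_rank_in kC k)) //= [X in _ + X]big1 => [|i].
  by rewrite mxE !rstE enum_rankK_in // eqxx mul1r addr0.
apply: contraNeq; rewrite mxE !rstE.
case: (enum_val i =P k) => [ik _|_]; last by rewrite mul0r eqxx.
by apply/eqP/enum_val_inj; rewrite enum_rankK_in.
Qed.

Lemma rstT_rst_supp n (M : 'M[R]_(\sum_i a_ i, n)) s :
  (forall k l, tagnat.sig1 k \notin s -> M k l = 0) -> (rst s)^T *m (rst s *m M) = M.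
Proof.
move=> M0; apply/matrixP => k l; rewrite mulmxA mxE (bigD1 k) //= [X in _ + X]big1 => [|i ik].
  rewrite rstT_rst eqxx addr0 /=.
  by have [_|/M0 ->] := boolP (_ \in s); rewrite ?mul1r ?mulr0.
by rewrite rstT_rst eq_sym (negbTE ik) mul0r.
Qed.

Lemma sqn_rstT s x : sqn ((rst s)^T *m x) = sqn x.
Proof. by rewrite -qf_gram trmxK rst_rstT qf_id. Qed.

Lemma sqn_rst_le s x : sqn (rst s *m x) <= sqn x.
Proof.
set E := rst s; pose z := x - E^T *m (E *m x).
have Ez : E *m z = 0 by rewrite mulmxBr (mulmxA E) rst_rstT mul1mx subrr.
have -> : sqn x = qf 1%:M (E^T *m (E *m x) + z) by rewrite qf_id addrC subrK.
rewrite qfD ?trmx1 // !qf_id sqn_rstT.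
have -> : bf 1%:M (E^T *m (E *m x)) z = 0.
  by rewrite /bf mulmx1 trmx_mul trmxK -mulmxA Ez mulmx0 mxE.
by rewrite mulr0 addr0 lerDl sqn_ge0.
Qed.

End Blocks.

Section Submatrices.
Context {R : realType} {p : nat}.
Implicit Types s r : {set 'I_p}.

Lemma submE (a_ b_ : 'I_p -> nat) (M : 'M[R]_(\sum_i a_ i, \sum_i b_ i)) s r :
  subm M s r = rst a_ s *m M *m (rst b_ r)^T.
Proof. by rewrite mul_rst_tr rst_mul; apply/matrixP => k l; rewrite !mxE. Qed.

Lemma subm1l (a_ : 'I_p -> nat) s r :
  subm (1%:M : 'M[R]_(\sum_i a_ i)) s r = rst a_ s *m (rst a_ r)^T.
Proof. by rewrite submE mulmx1. Qed.

Lemma qf_subm (a_ : 'I_p -> nat) (M : 'M[R]_(\sum_i a_ i)) s x :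
  qf (subm M s s) x = qf M ((rst a_ s)^T *m x).
Proof. by rewrite submE -{1}(trmxK (rst a_ s)) qf_congr. Qed.

Lemma psd_subm (a_ : 'I_p -> nat) (M : 'M[R]_(\sum_i a_ i)) s : psd M -> psd (subm M s s).
Proof. by move=> hM; rewrite submE -{1}(trmxK (rst a_ s)); exact: psd_congr. Qed.

Lemma sqn_subm (a_ b_ : 'I_p -> nat) (M : 'M[R]_(\sum_i a_ i, \sum_i b_ i)) s r e x :
  specnorm M <= e -> sqn (subm M s r *m x) <= e ^+ 2 * sqn x.
Proof.
move=> Me; rewrite submE -!mulmxA; apply: le_trans (sqn_rst_le _ _) _.
apply: le_trans (specnorm_bound _ _) _; rewrite sqn_rstT ler_wpM2r ?sqn_ge0 //.
by rewrite lerXn2r // nnegrE ?(le_trans _ Me) // specnorm_ge0.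
Qed.

Lemma submB (a_ b_ : 'I_p -> nat) (M M' : 'M[R]_(\sum_i a_ i, \sum_i b_ i)) s r :
  subm (M - M') s r = subm M s r - subm M' s r.
Proof. by rewrite !submE mulmxBr mulmxBl. Qed.

Lemma subvE (a_ : 'I_p -> nat) (v : 'cV[R]_(\sum_i a_ i)) s : subv v s = rst a_ s *m v.
Proof. by rewrite rst_mul. Qed.

Lemma stackE (a_ : 'I_p -> nat) (f : forall i, 'cV[R]_(#|coords a_ [set i]%SET|)) :
  stack f = \sum_i (rst a_ [set i]%SET)^T *m f i.
Proof. by apply: eq_bigr => i _; rewrite /rst trmx_mxsub trmx1. Qed.

Lemma sum_rstT_rst (a_ : 'I_p -> nat) (I : {set 'I_p}) :
  \sum_(i in I) (rst a_ [set i]%SET)^T *m rst a_ [set i]%SET = (rst a_ I)^T *m rst a_ I :> 'M[R]_(_).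
Proof.
apply/matrixP => k l; rewrite summxE rstT_rst.
transitivity (\sum_(i in I) ((k == l) && (tagnat.sig1 k \in [set i]%SET))%:R : R).
  by apply: eq_bigr => i _; rewrite rstT_rst.
move: (tagnat.sig1 k) (k == l) => i0 [|]; last by rewrite big1.
have [lI|lI] := boolP (i0 \in I).
  rewrite (bigD1 _ lI) /= inE eqxx big1 ?addr0 // => i /andP[_ il].
  by rewrite inE eq_sym (negbTE il).
rewrite big1 // => i iI; rewrite inE; case: eqP => // li.
by rewrite li iI in lI.
Qed.

Lemma sparse_entry (a_ b_ : 'I_p -> nat) (M : 'M[R]_(\sum_i a_ i, \sum_i b_ i)) k l :
  submxblock M (tagnat.sig1 k) (tagnat.sig1 l) = 0 -> M k l = 0.
Proof.
move=> /matrixP /(_ (tagnat.sig2 k) (tagnat.sig2 l)); rewrite !mxE.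
by rewrite !tagnat.sig2K.
Qed.

Section Support.
Variables (G : delay_graph p) (hG : delay_graph_wf G) (Nb : 'I_p -> {set 'I_p}).
Hypothesis hD : forall i j, j \in Nb i -> D_le G i j 1.

(** A subsystem directly affected by a member of r hears of it with delay at most 1, hence
belongs to the successor of r. So the columns r of M vanish outside the rows of that
successor, and cutting M down to this block loses nothing. *)
Lemma propagate (a_ b_ : 'I_p -> nat) (M : 'M[R]_(\sum_i a_ i, \sum_i b_ i)) r :
  (forall i j, j \notin Nb i -> submxblock M i j = 0) ->
  r \in nodes G ->
  M *m (rst b_ r)^T = (rst a_ (succ G r))^T *m subm M (succ G r) r.
Proof.
move=> M0 rn; rewrite submE -mulmxA rstT_rst_supp // => k l ks.
rewrite mul_rst_tr mxE; apply: sparse_entry; apply: M0.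
apply: contraNN ks => /hD; apply: mem_succ => //.
by have := enum_valP l; rewrite inE.
Qed.

End Support.
End Submatrices.

(** * Riccati and Lyapunov families of a network *)

Lemma theP (T : Type) (x0 : T) (S : T -> Prop) : (exists x, S x) -> S (the x0 S).
Proof. by move=> exS; rewrite /the; case: pselect => // h; case: cid. Qed.

Section RiccatiFamilies.
Context {R : realType} {p : nat} (G : delay_graph p) (hG : delay_graph_wf G).
Context {n_ m_ : 'I_p -> nat}.
Context (Q : 'M[R]_(\sum_i n_ i)) (Ru : 'M[R]_(\sum_i m_ i)).
Hypotheses (hQ : psd Q) (hQ1 : forall x, sqn x <= qf Q x).
Hypotheses (hR : pd Ru) (hR1 : forall x, sqn x <= qf Ru x).

Local Notation node := (fun r => r \in nodes G).
Local Notation dx := (fun r : {set 'I_p} => #|coords n_ r|).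
Local Notation du := (fun r : {set 'I_p} => #|coords m_ r|).

Lemma qf_subm_ge1 (a_ : 'I_p -> nat) (M : 'M[R]_(\sum_i a_ i)) r x :
  (forall y, sqn y <= qf M y) -> sqn x <= qf (subm M r r) x.
Proof. by move=> M1; rewrite qf_subm -(sqn_rstT x); exact: M1. Qed.

Lemma pd_subm r : pd (subm Ru r r).
Proof.
split; first by have [] := psd_subm r (pd_psd hR).
move=> x x0; rewrite -/(qf _ x); apply: lt_le_trans (qf_subm_ge1 x hR1).
by rewrite lt_neqAle sqn_ge0 andbT eq_sym; apply: contra_neq x0; exact: sqn_eq0.
Qed.

Definition stage_form (K : @gain_family R p n_ m_) (r : {set 'I_p}) :
    'M[R]_#|coords n_ r| :=
  subm Q r r + (K r)^T *m subm Ru r r *m K r.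

Lemma qf_stage_form K r x :
  qf (stage_form K r) x = qf (subm Q r r) x + qf (subm Ru r r) (K r *m x).
Proof. by rewrite /stage_form qfDl qf_congr. Qed.

Lemma stage_form_ge1 K r x : sqn x <= qf (stage_form K r) x.
Proof.
rewrite qf_stage_form; apply: le_trans (qf_subm_ge1 x hQ1) _.
by rewrite lerDl (pd_psd (pd_subm r)).2.
Qed.

Section System.
Variables (A : 'M[R]_(\sum_i n_ i)) (B : 'M[R]_(\sum_i n_ i, \sum_i m_ i)).

Lemma qf_cost_step K P r x : qf (cost_step G Q Ru A B K P r) x =
  qf (stage_form K r) x + qf (P (succ G r)) (closed_loop A B K (succ G r) r *m x).
Proof. by rewrite /cost_step qfDl qf_congr. Qed.

(** Positivity is required at the roots only; each step of the recursion
carries it one node further back. *)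
Lemma riccati_family_psd P : is_riccati_family G Q Ru A B P ->
  forall r, r \in nodes G -> psd (P r).
Proof.
move=> [PE Proot] r; apply: (node_ind hG (C := fun r => psd (P r))) => // {}r rn IH.
rewrite PE //; apply: psdD; last exact: psd_congr.
by apply: psdD; [exact: psd_subm|apply: psd_congr; exact/pd_psd/pd_subm].
Qed.

Lemma riccati_family_exists (S : @cost_family R p n_) (K : @gain_family R p n_ m_) :
  (forall r, r \in nodes G -> forall x, 0 <= qf (S r) x) ->
  (forall r, r \in nodes G -> forall x,
     qf (cost_step G Q Ru A B K S r) x <= qf (S r) x) ->
  is_riccati_family G Q Ru A B (riccati_cost G Q Ru A B).
Proof.
move=> S0 hS; apply: theP.
have [P hP] := @riccati_exists R _ node (succ G) dx du (succ_nodes hG)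
  (fun r => subm A (succ G r) r) (fun r => subm B (succ G r) r)
  (fun r => subm Q r r) (fun r => subm Ru r r) (fun r _ => psd_subm r hQ)
  (fun r _ => pd_subm r) S K S0 hS.
exists P; split=> [r /hP[]//|s /root_node /hP[]//].
Qed.

(** An instance of the Riccati equation: the closed loop of K as
dynamics, its stage cost as state cost, and no inputs. *)
Lemma lyapunov_family_exists (S : @cost_family R p n_) (K : @gain_family R p n_ m_) :
  (forall r, r \in nodes G -> forall x, 0 <= qf (S r) x) ->
  (forall r, r \in nodes G -> forall x,
     qf (cost_step G Q Ru A B K S r) x <= qf (S r) x) ->
  is_lyapunov_family G Q Ru A B K (lyapunov_cost G Q Ru A B K).
Proof.
move=> S0 hS; apply: theP.
have hstage r : psd (stage_form K r).
  by apply: psdD; [exact: psd_subm|apply: psd_congr; exact/pd_psd/pd_subm].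
have pd00 : pd (0 : 'M[R]_0).
  by split=> [|x]; [rewrite trmx0|rewrite [x]flatmx0 eqxx].
(* Input spaces of dimension 0, where the zero matrix is positive definite. *)
have [|P hP] := @riccati_exists R _ node (succ G) dx (fun=> 0%N) (succ_nodes hG)
  (fun r => closed_loop A B K (succ G r) r) (fun r => 0)
  (stage_form K) (fun r => 0) (fun r _ => hstage r)
  (fun r _ => pd00) S (fun r => 0) S0.
  move=> r rn x; apply: le_trans (hS r rn x).
  by rewrite qf_fstep qf_fstage /fcl /= !mulmx0 addr0 qf0 addr0 qf_cost_step.
exists P => r /hP[_]; rewrite /fstep /fcl /= mul0mx addr0 mulmx0 mul0mx addr0 => {1}->.
by rewrite /cost_step.
Qed.

End System.

Section Nearby.
Variables (A A' : 'M[R]_(\sum_i n_ i)) (B B' : 'M[R]_(\sum_i n_ i, \sum_i m_ i)).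
Variables (P : @cost_family R p n_) (g eps dl : R).
Hypothesis hP : is_riccati_family G Q Ru A B P.
Hypothesis Pg : forall r, r \in nodes G -> forall x, qf (P r) x <= g * sqn x.
Hypotheses (g1 : 1 <= g) (dl0 : 0 < dl <= 1) (gdl : 3 * g * dl < 1).
Hypotheses (hA : specnorm (A' - A) <= eps) (hB : specnorm (B' - B) <= eps).
Hypothesis hdl : 2 * eps ^+ 2 * (1 + g) <= dl ^+ 2.
Let K := gain G Ru A B P.

Lemma nearby_riccatiE r : r \in nodes G -> forall x,
  qf (P r) x = qf (stage_form K r) x +
    qf (P (succ G r)) (closed_loop A B K (succ G r) r *m x).
Proof. by move=> rn x; rewrite {1}hP.1 // qf_cost_step. Qed.

(** The size of the gain is controlled through the cost: |K x|^2 is at most the input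
cost of K x, hence at most the form of P at x. *)
Lemma nearby_closed_loop r : r \in nodes G -> forall x,
  sqn ((closed_loop A' B' K (succ G r) r - closed_loop A B K (succ G r) r) *m x)
    <= dl ^+ 2 * sqn x.
Proof.
move=> rn x.
have Kg : sqn (K r *m x) <= g * sqn x.
  apply: le_trans (qf_subm_ge1 _ hR1) _; apply: le_trans (Pg rn x).
  rewrite nearby_riccatiE // qf_stage_form -addrA addrCA lerDl addr_ge0 //.
    by rewrite (psd_subm r hQ).2.
  exact: (riccati_family_psd hP (succ_nodes hG rn)).2.
have -> : closed_loop A' B' K (succ G r) r - closed_loop A B K (succ G r) r =
    subm (A' - A) (succ G r) r + subm (B' - B) (succ G r) r *m K r.
  by rewrite /closed_loop !submB mulmxBl opprD addrACA.
rewrite mulmxDl -mulmxA; apply: le_trans (sqnD _ _) _.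
have hx := sqn_subm (succ G r) x hA.
have hu := sqn_subm (succ G r) (K r *m x) hB.
have hu' : eps ^+ 2 * sqn (K r *m x) <= eps ^+ 2 * (g * sqn x).
  by rewrite ler_wpM2l // sqr_ge0.
have hd : 2 * eps ^+ 2 * (1 + g) * sqn x <= dl ^+ 2 * sqn x.
  by rewrite ler_wpM2r // sqn_ge0.
by lra.
Qed.

Let Ppsd := riccati_family_psd hP.
Let stage1 (r : {set 'I_p}) (rn : r \in nodes G) := @stage_form_ge1 K r.
Let cl' r := closed_loop A' B' K (succ G r) r.

Lemma nearby_supersolution r : r \in nodes G -> forall x,
  (1 - 3 * g * dl) * qf (stage_form K r) x + qf (P (succ G r)) (cl' r *m x)
    <= qf (P r) x.
Proof.
exact: (perturbed_supersolution (succ_nodes hG) g1 dl0 stage1 Ppsd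
  nearby_riccatiE Pg nearby_closed_loop).
Qed.

Lemma nearby_contraction r : r \in nodes G -> forall x,
  qf (P (succ G r)) (cl' r *m x) <= rate g dl * qf (P r) x.
Proof.
exact: (perturbed_contraction (succ_nodes hG) g1 dl0 gdl stage1 Ppsd
  nearby_riccatiE Pg nearby_closed_loop).
Qed.

Lemma nearby_compare (X : @cost_family R p n_) :
  (forall r, r \in nodes G -> forall x,
     qf (X r) x <= qf (stage_form K r) x + qf (X (succ G r)) (cl' r *m x)) ->
  forall r, r \in nodes G -> forall x, (1 - 3 * g * dl) * qf (X r) x <= qf (P r) x.
Proof.
exact: (perturbed_compare (succ_nodes hG) g1 dl0 gdl stage1 Ppsd
  nearby_riccatiE Pg nearby_closed_loop).
Qed.

Lemma nearby_riccati_ge1 r x : r \in nodes G -> sqn x <= qf (P r) x.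
Proof.
move=> rn; rewrite nearby_riccatiE //; apply: le_trans (stage_form_ge1 K x) _.
by rewrite lerDl (Ppsd (succ_nodes hG rn)).2.
Qed.

Let S r := (1 - 3 * g * dl)^-1 *: P r.

Let S_ge0 r : r \in nodes G -> forall x, 0 <= qf (S r) x.
Proof.
move=> rn x; rewrite qfZ mulr_ge0 ?invr_ge0 ?subr_ge0 ?(ltW gdl) //.
exact: (Ppsd rn).2.
Qed.

Let S_super r : r \in nodes G -> forall x,
  qf (cost_step G Q Ru A' B' K S r) x <= qf (S r) x.
Proof.
move=> rn x; have eta0 : 0 < 1 - 3 * g * dl by rewrite subr_gt0.
rewrite qf_cost_step /S !qfZ -(ler_pM2l eta0) mulrDr !mulVKf ?gt_eqF //.
exact: nearby_supersolution.
Qed.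

(** The multiple 1 / (1 - 3 g dl) of P is a supersolution for the perturbed system. *)
Lemma nearby_riccati : is_riccati_family G Q Ru A' B' (riccati_cost G Q Ru A' B').
Proof. exact: riccati_family_exists S_ge0 S_super. Qed.

Lemma nearby_lyapunov : is_lyapunov_family G Q Ru A' B' K (lyapunov_cost G Q Ru A' B' K).
Proof. exact: lyapunov_family_exists S_ge0 S_super. Qed.

(** The gains K are admissible for the perturbed system, where P' is optimal. So P' is a
subsolution of the recursion of K. *)
Lemma riccati_le (P' : @cost_family R p n_) : is_riccati_family G Q Ru A' B' P' ->
  forall r, r \in nodes G -> forall x, (1 - 3 * g * dl) * qf (P' r) x <= qf (P r) x.
Proof.
move=> hP'; apply: nearby_compare => r rn x; rewrite {1}hP'.1 //.
have := @fstep_gain_le R _ (succ G) dx du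
  (fun r => subm A' (succ G r) r) (fun r => subm B' (succ G r) r)
  (fun r => subm Q r r) (fun r => subm Ru r r) P' r (pd_subm r)
  (riccati_family_psd hP' (succ_nodes hG rn)) K x.
move/le_trans; apply; rewrite qf_fstep; exact: lexx.
Qed.

Lemma lyapunov_le (X : @cost_family R p n_) : is_lyapunov_family G Q Ru A' B' K X ->
  forall r, r \in nodes G -> forall x, (1 - 3 * g * dl) * qf (X r) x <= qf (P r) x.
Proof.
by move=> hX; apply: nearby_compare => r rn x; rewrite {1}hX // qf_cost_step.
Qed.

End Nearby.

Section StableSystem.
Local Open Scope classical_set_scope.
Variables (A : 'M[R]_(\sum_i n_ i)) (B : 'M[R]_(\sum_i n_ i, \sum_i m_ i)).
Variables (Nb : 'I_p -> {set 'I_p}) (kap gam : R).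
Hypothesis hD : forall i j, j \in Nb i -> D_le G i j 1.
Hypothesis hA0 : forall i j, j \notin Nb i -> submxblock A i j = 0.
Hypothesis gam01 : 0 <= gam < 1.
Hypothesis Apow : forall k, specnorm (A ^+ k) <= kap * gam ^+ k.

Lemma power_half : exists k, forall x, sqn (A ^+ k *m x) <= 2^-1 * sqn x.
Proof.
have /andP[gam0 gam1] := gam01.
have kap0 : 0 <= kap.
  by have := Apow 0; rewrite mulr1; apply: le_trans; exact: specnorm_ge0.
have cv : (kap * gam ^+ k) ^+ 2 @[k --> \oo] --> (0 : R).
  have cv1 : kap * gam ^+ k @[k --> \oo] --> (0 : R).
    rewrite -[X in _ --> X](mulr0 kap); apply: cvgMr.
    by apply: cvg_expr; rewrite ger0_norm.
  rewrite -[X in _ --> X](mulr0 (0 : R)); under eq_fun do rewrite expr2.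
  exact: cvgM.
have [k _ /(_ k (leqnn k)) hk] : \forall k \near \oo, (kap * gam ^+ k) ^+ 2 < (2^-1 : R).
  by apply: (cvgr_lt _ cv); rewrite invr_gt0.
exists k => x; apply: le_trans (specnorm_bound _ _) _.
rewrite ler_wpM2r ?sqn_ge0 //; apply: le_trans (ltW hk).
by rewrite lerXn2r // nnegrE ?specnorm_ge0 // mulr_ge0 ?exprn_ge0.
Qed.

(** If |A^k x|^2 <= |x|^2 / 2, then the sum of the (A^j)^T A^j over j < k decreases along A
by at least |x|^2 / 2; a multiple of it pays for the state cost Q. *)
Lemma stable_supersolution : exists S : 'M[R]_(\sum_i n_ i),
  forall x, 0 <= qf S x /\ qf Q x + qf S (A *m x) <= qf S x.
Proof.
have [k hk] := power_half; have [c c0 hc] := qf_abs_bound Q.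
pose S0 := \sum_(j < k) (A ^+ j)^T *m A ^+ j.
have S0E x : qf S0 x = \sum_(j < k) sqn (A ^+ j *m x).
  rewrite /S0; elim: k {hk S0} => [|k IH]; first by rewrite !big_ord0 qf0.
  by rewrite !big_ord_recr /= qfDl IH qf_gram.
have step x : qf S0 (A *m x) = qf S0 x - sqn x + sqn (A ^+ k *m x).
  have tele (f : nat -> R) l : \sum_(j < l) f j.+1 = \sum_(j < l) f j - f 0%N + f l.
    by elim: l => [|l IH]; [rewrite !big_ord0|rewrite !big_ord_recr /= IH]; ring.
  have := tele (fun j => sqn (A ^+ j *m x)) k; rewrite !S0E expr0 mul1mx => <-.
  by apply: eq_bigr => j _; rewrite exprSr mulmxA.
exists ((2 * c) *: S0) => x; rewrite !qfZ; split.
  by rewrite !mulr_ge0 // S0E sumr_ge0 // => j _; exact: sqn_ge0.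
rewrite step; have := hk x; have := hc x; have := ler_norm (qf Q x).
have s0 := sqn_ge0 x.
move: (sqn (A ^+ k *m x)) (qf Q x) => a q h1 h2 h3.
have : c * a <= c * (2^-1 * sqn x) by rewrite ler_wpM2l.
by lra.
Qed.

(** With zero gains, the blocks of one supersolution of the whole system form a
supersolution of the recursion, because the dynamics maps the coordinates of r into
those of its successor. *)
Lemma stable_riccati : is_riccati_family G Q Ru A B (riccati_cost G Q Ru A B).
Proof.
have [S hS] := stable_supersolution.
apply: (@riccati_family_exists A B (fun r => subm S r r) (fun r => 0)).
  by move=> r rn x; rewrite qf_subm; have [] := hS ((rst n_ r)^T *m x).
move=> r rn x; rewrite qf_cost_step qf_stage_form mul0mx /closed_loop mulmx0 addr0.
have -> : qf (subm Ru r r) 0 = 0 by rewrite /qf mulmx0 mxE.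
rewrite addr0 !qf_subm mulmxA -(propagate hG hD hA0 rn) -mulmxA.
by have [] := hS ((rst n_ r)^T *m x).
Qed.

End StableSystem.
End RiccatiFamilies.

(** * Moments of the centered normal law *)

Section NormalMoments.
Local Open Scope classical_set_scope.
Context {R : realType} (s : R).
Hypothesis s0 : 0 < s.
Local Notation mu := (@lebesgue_measure R).
Local Notation pdf := (normal_pdf 0 s).
Local Notation N := (normal_prob 0 s).

Let sn0 : s != 0. Proof. by rewrite gt_eqF. Qed.

(** The density of the normal law and its Radon-Nikodym derivative have
the same integrals, hence agree almost everywhere. *)
Lemma ge0_integral_normal_prob (f : R -> R) : (forall x, 0 <= f x) ->
  measurable_fun setT f ->
  (\int[N]_x (f x)%:E = \int[mu]_x (f x * pdf x)%:E)%E.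
Proof.
move=> f0 mf; have dom := normal_prob_dominates 0 s.
rewrite -(Radon_Nikodym_SigmaFinite.change_of_variables dom) //; last exact/measurable_EFinP.
apply: ae_eq_integral => //.
- apply: emeasurable_funM; first exact/measurable_EFinP.
  exact: measurable_int (Radon_Nikodym_SigmaFinite.f_integrable dom).
- apply/measurable_EFinP/measurable_funM => //; exact: measurable_normal_pdf.
- under [X in ae_eq _ _ _ X]eq_fun do rewrite EFinM.
  apply: ae_eqe_mul2l; apply: integral_ae_eq => //.
  + exact: Radon_Nikodym_SigmaFinite.f_integrable.
  + by apply/measurable_EFinP; exact: measurable_normal_pdf.
  + by move=> E _ mE; rewrite -(Radon_Nikodym_SigmaFinite.f_integral dom).
Qed.

Lemma ge0_integralT_split (G : R -> R) : (forall x, 0 <= G x) -> continuous G ->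
  (\int[mu]_x (G x)%:E =
   \int[mu]_(x in `[0%R, +oo[) (G x)%:E + \int[mu]_(x in `[0%R, +oo[) (G (- x)%R)%:E)%E.
Proof.
move=> G0 cG.
have mG : measurable_fun [set: R] G by exact: continuous_measurable_fun.
have mpos : measurable [set x : R | 0 <= x] by rewrite -set_itvcy.
rewrite -(setUv [set x : R | 0 <= x]) ge0_integral_setU //=; last 4 first.
  exact: measurableC.
  by apply/measurable_EFinP; rewrite setUv.
  by move=> x _; rewrite lee_fin.
  exact/disj_setPCl.
rewrite -set_itvcy // setCitvr; congr (_ + _)%E.
rewrite integral_itv_bndo_bndc; last exact/measurable_EFinP/measurable_funTS.
rewrite -{1}oppr0 ge0_integration_by_substitutionNy //.
exact: continuous_subspaceT.
Qed.

Lemma normal_pdfN x : pdf (- x) = pdf x.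
Proof. by rewrite !normal_pdfE // /normal_fun !subr0 sqrrN. Qed.

(** From exp u >= 1 + u at u = x^2 / (2 s^2). *)
Lemma pdf_le x : 0 < x -> pdf x * x <= normal_peak s * (2 * s ^+ 2) / x.
Proof.
move=> x0; rewrite normal_pdfE // -!(mulrA (normal_peak s)) ler_wpM2l ?normal_peak_ge0 //.
rewrite /normal_fun subr0 mulNr expRN ler_pdivlMr // -mulrA mulrC ler_pdivrMr ?expR_gt0 //.
have s2 : 0 < s ^+ 2 by rewrite exprn_gt0.
apply: le_trans (_ : 2 * s ^+ 2 * (1 + x ^+ 2 / (s ^+ 2 *+ 2)) <= _).
  rewrite mulrDr mulr1 -[_ *+ 2]mulr_natr [X in _ <= _ + X](_ : _ = x * x) ?lerDr.
    by rewrite mulr_ge0 // ltW.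
  by field; rewrite gt_eqF.
by rewrite ler_pM2l ?mulr_gt0 // expR_ge1Dx.
Qed.

Lemma pdf_tail : pdf n%:R * n%:R @[n --> \oo] --> (0 : R).
Proof.
apply: (@squeeze_cvgr _ _ _ _ (fun=> 0) (fun n => normal_peak s * (2 * s ^+ 2) / n%:R)).
- near=> n; have n0 : 0 < n%:R :> R by rewrite ltr0n; near: n; exists 1%N.
  by rewrite mulr_ge0 ?normal_pdf_ge0 //= pdf_le.
- exact: cvg_cst.
- rewrite -[X in _ --> X](mulr0 (normal_peak s * (2 * s ^+ 2))).
  apply: cvgMr; rewrite -cvg_shiftS /=; exact: cvg_harmonic.
Unshelve. all: by end_near.
Qed.

Let F x : R := - (s ^+ 2) * (pdf x * x).
Let h x : R := (x ^+ 2 - s ^+ 2) * pdf x.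

Lemma derive_pdf (x : R) : is_derive x 1 pdf (- (x / s ^+ 2) * pdf x).
Proof.
have -> : pdf = (fun x => normal_peak s * expR (- (2 * s ^+ 2)^-1 * (x * x))).
  apply/funext => y; rewrite normal_pdfE // /normal_fun subr0.
  by congr (_ * expR _); rewrite -[_ *+ 2]mulr_natl; field.
apply: is_derive_eq.
rewrite /GRing.scale /=; field.
by rewrite sn0.
Qed.

Lemma is_derive_F (x : R) : is_derive x 1 F (h x).
Proof.
have := derive_pdf x => dp; rewrite /F /h; apply: is_derive_eq.
by rewrite /GRing.scale /=; field; rewrite sn0.
Qed.

Let continuous_F : continuous F.
Proof.
by move=> x; apply/differentiable_continuous/derivable1_diffP; case: (is_derive_F x).
Qed.

Let cpdf : continuous pdf. Proof. exact: continuous_normal_pdf. Qed.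

Let csqr : continuous (fun x : R => x ^+ 2 * pdf x).
Proof. by move=> x; apply: cvgM; [exact: exprn_continuous|exact: cpdf]. Qed.

Let ch : continuous h.
Proof.
move=> x; apply: cvgM; last exact: cpdf.
by apply: cvgB; [exact: exprn_continuous|exact: cvg_cst].
Qed.

(** The function -s^2 x pdf(x) is an antiderivative of (x^2 - s^2) pdf(x). *)
Lemma FTC_second_moment (n : nat) :
  (\int[mu]_(x in `[0%R, n.+1%:R]) (x ^+ 2 * pdf x)%:E =
   (s ^+ 2)%:E * \int[mu]_(x in `[0%R, n.+1%:R]) (pdf x)%:E + (F n.+1%:R)%:E)%E.
Proof.
have ci (f : R -> R) : continuous f -> mu.-integrable `[0%R, n.+1%:R] (EFin \o f).
  move=> cf; apply: continuous_compact_integrable; first exact: segment_compact.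
  exact: continuous_subspaceT.
have hE : (\int[mu]_(x in `[0%R, n.+1%:R]) (h x)%:E = (F n.+1%:R)%:E)%E.
  rewrite (@continuous_FTC2 R h F) //.
  - by rewrite /F mulr0 mulr0 sube0.
  - exact: continuous_subspaceT.
  - split.
    + by move=> x _; case: (is_derive_F x).
    + exact/cvg_at_right_filter/continuous_F.
    + exact/cvg_at_left_filter/continuous_F.
  - by move=> x _; rewrite derive1E; case: (is_derive_F x).
rewrite -hE -integralZl //; last exact: ci.
rewrite -integralD //; last 2 first.
- by apply: integrableZl => //; exact: ci.
- exact: ci.
by apply: eq_integral => x _; rewrite -EFinM -EFinD /h; congr EFin; ring.
Qed.

Lemma half_mass : (\int[mu]_(x in `[0%R, +oo[) (pdf x)%:E = (2^-1)%:E :> \bar R)%E.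
Proof.
have := integral_normal_pdf 0 s; rewrite ge0_integralT_split //; last first.
  by move=> x; exact: normal_pdf_ge0.
under [X in (_ + X)%E]eq_integral do rewrite normal_pdfN.
have : (0 <= \int[mu]_(x in `[0%R, +oo[) (pdf x)%:E)%E.
  by apply: integral_ge0 => x _; rewrite lee_fin normal_pdf_ge0.
case: (\int[mu]_(x in _) _)%E => [r||] //= _ [rr].
by congr EFin; lra.
Qed.

Lemma second_moment_half :
  (\int[mu]_(x in `[0%R, +oo[) (x ^+ 2 * pdf x)%:E = (s ^+ 2 / 2)%:E :> \bar R)%E.
Proof.
have pos x : 0 <= x ^+ 2 * pdf x by rewrite mulr_ge0 ?sqr_ge0 ?normal_pdf_ge0.
have c1 := @ge0_cvgn_integral R mu _ pos (continuous_measurable_fun csqr).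
have c2 := @ge0_cvgn_integral R mu _ (normal_pdf_ge0 0 s) (measurable_normal_pdf 0 s).
rewrite half_mass in c2.
have c3 : (F n%:R)%:E @[n --> \oo] --> (0%:E : \bar R).
  apply: cvg_EFin; first by near=> n.
  rewrite -[X in _ --> X](mulr0 (- (s ^+ 2))); apply: cvgMr; exact: pdf_tail.
have := c1; rewrite -cvg_shiftS; set u := (X in X @ _ --> _ -> _) => {}c1.
have c4 : u n @[n --> \oo] --> (s ^+ 2 / 2)%:E.
  have -> : u = (fun n => (s ^+ 2)%:E * \int[mu]_(x in `[0%R, n.+1%:R]) (pdf x)%:E
      + (F n.+1%:R)%:E)%E by apply/funext => n; exact: FTC_second_moment.
  rewrite [X in _ --> X](_ : _ = (s ^+ 2)%:E * (2^-1)%:E + 0)%E; last by rewrite adde0 -EFinM.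
  apply: cvgeD => //.
    apply: cvgeZl => //; rewrite -cvg_shiftS in c2; exact: c2.
  by rewrite -cvg_shiftS in c3; exact: c3.
exact: (cvg_unique (@ereal_hausdorff R) c1 c4).
Unshelve. all: by end_near.
Qed.

Lemma measurable_sqr : measurable_fun [set: R] (fun x : R => x ^+ 2).
Proof. by apply: measurable_funX; exact: measurable_id. Qed.

Lemma normal_second_moment : (\int[N]_x (x ^+ 2)%:E = (s ^+ 2)%:E :> \bar R)%E.
Proof.
rewrite ge0_integral_normal_prob; last 2 first.
- by move=> x; exact: sqr_ge0.
- exact: measurable_sqr.
rewrite ge0_integralT_split //; last first.
  by move=> x; rewrite mulr_ge0 ?sqr_ge0 ?normal_pdf_ge0.
under [X in (_ + X)%E]eq_integral do rewrite normal_pdfN sqrrN.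
by rewrite second_moment_half -EFinD; congr EFin; field.
Qed.

Lemma normal_integrable_id : N.-integrable setT (EFin \o (@id R)).
Proof.
have mid : measurable_fun [set: R] (@id R) by exact: measurable_id.
apply: (@le_integrable _ _ _ N _ measurableT _ (EFin \o (fun x : R => 1 + x ^+ 2))).
- exact/measurable_EFinP.
- move=> x _ /=; rewrite lee_fin [leRHS]ger0_norm ?addr_ge0 ?sqr_ge0 //.
  rewrite -[x ^+ 2]real_normK ?num_real //.
  by have := sqr_ge0 (`|x| - 1); have := normr_ge0 x; nra.
- apply/integrableP; split.
    exact/measurable_EFinP/measurable_funD.
  under eq_integral => x _ do rewrite /= ger0_norm ?addr_ge0 ?sqr_ge0 // EFinD.
  rewrite ge0_integralD //=; last 2 first.
  + by move=> x _; rewrite lee_fin sqr_ge0.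
  + by apply/measurable_EFinP; exact: measurable_sqr.
  have -> : (\int[N]__ 1 = 1%E :> \bar R)%E.
    by rewrite integral_cst // mul1e; exact: probability_setT.
  by rewrite normal_second_moment ltry.
Qed.

(** The reflection at 0 exchanges the positive and the negative part of the integrand. *)
Lemma normal_mean : (\int[N]_x x%:E = 0 :> \bar R)%E.
Proof.
have cmax : continuous (fun x : R => Num.max x 0).
  by move=> x; apply: continuous_max => //; exact: cvg_cst.
have cmaxN : continuous (fun x : R => Num.max (- x) 0).
  by move=> x; apply: (continuous_comp _ (cmax (- x))); exact: opp_continuous.
have max0 (x : R) : 0 <= Num.max x 0 by rewrite le_max lexx orbT.
have even : (\int[N]_x (Num.max x 0)%:E = \int[N]_x (Num.max (- x) 0)%:E)%E.
  rewrite !ge0_integral_normal_prob //; try exact: continuous_measurable_fun.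
  have cG : continuous (fun x : R => Num.max x 0 * pdf x).
    by move=> x; apply: cvgM; [exact: cmax|exact: cpdf].
  have cGN : continuous (fun x : R => Num.max (- x) 0 * pdf x).
    by move=> x; apply: cvgM; [exact: cmaxN|exact: cpdf].
  rewrite [LHS]ge0_integralT_split // => [|x]; last by rewrite mulr_ge0 ?normal_pdf_ge0.
  rewrite [RHS]ge0_integralT_split // => [|x]; last by rewrite mulr_ge0 ?normal_pdf_ge0.
  under [X in (_ + X = _)%E]eq_integral do rewrite normal_pdfN.
  under [X in (_ = _ + X)%E]eq_integral do rewrite normal_pdfN opprK.
  exact: addeC.
have fin : (\int[N]_x (Num.max (- x) 0)%:E)%E \is a fin_num.
  have -> : (\int[N]_x (Num.max (- x) 0)%:E = \int[N]_x (EFin \o id)^\- x)%E.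
    by apply: eq_integral => x _; rewrite funenegE /= EFin_max.
  by apply: integrable_fin_num => //; apply: integrable_funeneg => //; exact: normal_integrable_id.
rewrite integralE; have -> : (\int[N]_x (EFin^\+ x) = \int[N]_x (Num.max x 0)%:E)%E.
  by apply: eq_integral => x _; rewrite funeposE EFin_max.
have -> : (\int[N]_x (EFin^\- x) = \int[N]_x (Num.max (- x) 0)%:E)%E.
  by apply: eq_integral => x _; rewrite funenegE -EFinN EFin_max.
by rewrite even subee.
Qed.

End NormalMoments.

(** * Second moments of the noise *)

Section Moments.
Local Open Scope classical_set_scope.
Context {R : realType} {dO : measure_display} {Omega : measurableType dO}.
Context (Pr : probability Omega R).

Definition has_mean (X : Omega -> R) (v : R) : Prop :=
  Pr.-integrable setT (EFin \o X) /\ (\int[Pr]_o (X o)%:E = v%:E)%E.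

Lemma has_mean0 : has_mean (fun=> 0) 0.
Proof. by split; [exact: integrable0|exact: integral0]. Qed.

Lemma has_meanD X Y a b : has_mean X a -> has_mean Y b ->
  has_mean (fun o => X o + Y o) (a + b).
Proof.
move=> [iX EX] [iY EY]; split.
  have -> : EFin \o (fun o => X o + Y o) = ((EFin \o X) \+ (EFin \o Y))%E by [].
  exact: integrableD.
by under eq_integral do rewrite EFinD; rewrite integralD //= EX EY.
Qed.

Lemma has_meanZ X a c : has_mean X a -> has_mean (fun o => c * X o) (c * a).
Proof.
move=> [iX EX]; split; first exact: (integrableZl measurableT c iX).
by under eq_integral do rewrite EFinM; rewrite integralZl //= EX.
Qed.

Lemma has_mean_sum (I : Type) (r : seq I) (Q : pred I) (X : I -> Omega -> R) a :
  (forall i, Q i -> has_mean (X i) (a i)) ->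
  has_mean (fun o => \sum_(i <- r | Q i) X i o) (\sum_(i <- r | Q i) a i).
Proof.
move=> h; elim: r => [|i r IH].
  by rewrite big_nil; under [fun=> _]funext do rewrite big_nil; exact: has_mean0.
rewrite big_cons; under [fun=> _]funext do rewrite big_cons.
by case: ifP => // Qi; apply: has_meanD => //; exact: h.
Qed.

Lemma has_mean_eq X a b : a = b -> has_mean X a -> has_mean X b.
Proof. by move=> ->. Qed.

Lemma has_mean_expectation X a : has_mean X a -> ('E_Pr[X] = a%:E)%E.
Proof. by case=> _; rewrite unlock. Qed.

Variables (s : R) (s0 : 0 < s).
Local Notation N := (normal_prob 0 s).

Section Pair.
Variables X Y : {mfun Omega >-> measurableTypeR R}.
Hypothesis lawX : forall E, measurable E -> Pr (X @^-1` E) = N E.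

Let mX : measurable_fun setT (X : Omega -> R).
Proof. exact: (measurable_funPT X). Qed.
Let mY : measurable_fun setT (Y : Omega -> R).
Proof. exact: (measurable_funPT Y). Qed.

Lemma normal_has_second_moment : has_mean (fun o => X o * X o) (s ^+ 2).
Proof.
have mean : (\int[Pr]_o (X o * X o)%:E = (s ^+ 2)%:E)%E.
  rewrite -(normal_second_moment s0).
  transitivity (\int[distribution Pr X]_x (x ^+ 2)%:E)%E; last first.
    by apply: eq_measure_integral => A mA _; exact: lawX.
  rewrite ge0_integral_pushforward //.
  - by apply/measurable_EFinP; exact: measurable_sqr.
  - by move=> x _; rewrite lee_fin sqr_ge0.
split=> //; apply/integrableP; split.
  by apply/measurable_EFinP; exact: (measurable_funM mX mX).
under eq_integral => o _ do rewrite /= ger0_norm -?expr2 ?sqr_ge0 // expr2.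
by rewrite mean ltry.
Qed.

Hypothesis lawXY : forall E F, measurable E -> measurable F ->
  Pr ((X @^-1` E) `&` (Y @^-1` F)) = (N E * N F)%E.

(** The joint law agrees with the product law on rectangles, hence
everywhere; Fubini's theorem then factors the integral. *)
Lemma independent_has_mean0 : has_mean (fun o => X o * Y o) 0.
Proof.
have mXY : measurable_fun setT (fun o => (X o, Y o)).
  by apply: measurable_fun_pair; exact: measurable_funPT.
pose XY : {mfun Omega >-> (measurableTypeR R * measurableTypeR R)%type} := mfun_Sub (mem_set mXY).
pose g (z : R * R) : R := z.1 * z.2.
have mg : measurable_fun setT g.
  by apply: measurable_funM; [exact: measurable_fst|exact: measurable_snd].
have law A : measurable A -> distribution Pr XY A = (N \x N)%E A.
  by move=> mA; apply/esym; apply: product_measure_unique => // E F mE mF; exact: lawXY.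
have ig : (N \x N)%E.-integrable setT (EFin \o g).
  apply/integrable12ltyP; first exact/measurable_EFinP.
  have [_] := integrableP _ _ _ (normal_integrable_id s0) => iN.
  have mabs : measurable_fun [set: measurableTypeR R] (fun x : R => `|x|%:E).
    apply/measurable_EFinP; apply: (@continuous_measurable_fun R (fun x : R => `|x|)).
    exact: (@norm_continuous _ R^o).
  under eq_integral => x _.
    under eq_integral => y _ do rewrite /= /g /= normrM EFinM.
    rewrite ge0_integralZl //=.
    over.
  rewrite ge0_integralZr //; last by apply: integral_ge0.
  by apply: lte_mul_pinfty => //; rewrite ?integral_ge0 // ge0_fin_numE // integral_ge0.
have mean0 : (\int[N \x N]_z (g z)%:E = 0 :> \bar R)%E.
  rewrite -(integral12_prod_meas1 ig) /fubini_F.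
  rewrite integral0_eq // => x _.
  under eq_integral => y _ do rewrite /= /g /= EFinM.
  by rewrite integralZl //= ?normal_mean // ?mule0 //; exact: normal_integrable_id.
have iXY : (distribution Pr XY).-integrable setT (EFin \o g).
  have [mg' fing] := integrableP _ _ _ ig; apply/integrableP; split => //.
  by rewrite (eq_measure_integral (N \x N)%E) // => A mA _; exact: law.
have [mg' fing] := integrableP _ _ _ iXY.
have iOm : Pr.-integrable setT (EFin \o (fun o => X o * Y o)).
  apply/integrableP; split.
    by apply/measurable_EFinP; exact: (measurable_funM mX mY).
  move: fing; rewrite ge0_integral_pushforward //.
  exact: measurableT_comp.
split=> //; rewrite -[RHS]mean0.
have <- : (\int[distribution Pr XY]_z (g z)%:E = \int[N \x N]_z (g z)%:E)%E.
  by apply: eq_measure_integral => A mA _; exact: law.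
by rewrite integral_pushforward.
Qed.

End Pair.
Section Noise.
Variables (n : nat) (w : nat -> Omega -> 'cV[R]_n).
Hypothesis hw : iid_gaussian Pr s w.

Let NT : N setT = 1%E. Proof. exact: (@probability_setT _ _ _ (normal_prob 0 s)). Qed.

Lemma noise_law2 t k l (E F : set R) : k != l -> measurable E -> measurable F ->
  Pr (((fun o => w t o k 0) @^-1` E) `&` ((fun o => w t o l 0) @^-1` F))
  = (N E * N F)%E.
Proof.
move=> kl mE mF; have [_ gw _] := hw.
pose EF j := if j == k then E else if j == l then F else setT.
have mEF j : measurable (EF j) by rewrite /EF; case: ifP => // _; case: ifP.
have := gw t EF mEF.
rewrite (bigD1 k) //= (bigD1 l) /=; last by rewrite eq_sym.
rewrite big1 => [|j /andP[jk jl]]; last by rewrite /EF (negbTE jk) (negbTE jl).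
rewrite /EF eqxx eq_sym (negbTE kl) eqxx mule1 => <-; congr (Pr _).
apply/seteqP; split=> [x [Eo Fo] j _ /=|x h].
  by case: eqP => [->|_] //; case: eqP => [->|].
split; first by have := h k I; rewrite /= eqxx.
by have := h l I; rewrite /= eq_sym (negbTE kl) eqxx.
Qed.

Lemma noise_law t k (E : set R) : measurable E ->
  Pr ((fun o => w t o k 0) @^-1` E) = N E.
Proof.
move=> mE; have [_ gw _] := hw.
pose EF j := if j == k then E else setT.
have mEF j : measurable (EF j) by rewrite /EF; case: ifP.
have := gw t EF mEF.
rewrite (bigD1 k) //= big1 => [|j jk]; last by rewrite /EF (negbTE jk).
rewrite /EF eqxx mule1 => <-; congr (Pr _).
apply/seteqP; split=> [x Ex j _ /=|x h]; first by case: eqP => [->|].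
by have := h k I; rewrite /= eqxx.
Qed.

Lemma noise_law_times t t' k l (E F : set R) : t != t' ->
  measurable E -> measurable F ->
  Pr (((fun o => w t o k 0) @^-1` E) `&` ((fun o => w t' o l 0) @^-1` F))
  = (N E * N F)%E.
Proof.
move=> tt' mE mF; have [_ _ iw] := hw.
(* The product rule for a pair of times, all other events being sure. *)
pose EF (j : nat) := if j == t then ((fun o => w t o k 0) @^-1` E)
  else if j == t' then ((fun o => w t' o l 0) @^-1` F) else setT.
have sEF j : vec_sigma_algebra (w j) (EF j).
  rewrite /EF; case: eqP => [->|_].
    by apply: sub_sigma_algebra; exists k, E.
  case: eqP => [->|_]; first by apply: sub_sigma_algebra; exists l, F.
  (* The sure event is generated by any coordinate. *)
  by apply: sub_sigma_algebra; exists k, setT; split; first exact: measurableT.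
have := iw (maxn t t').+1 EF sEF.
have ht : (t < (maxn t t').+1)%N by rewrite ltnS leq_maxl.
have ht' : (t' < (maxn t t').+1)%N by rewrite ltnS leq_maxr.
rewrite (bigD1 (Ordinal ht)) //= (bigD1 (Ordinal ht')) /=; last by rewrite -val_eqE eq_sym.
rewrite big1 => [|j /andP[jk jl]]; last first.
  by rewrite /EF; move: jk jl; rewrite -!val_eqE /= => /negbTE -> /negbTE ->; exact: probability_setT.
rewrite /EF eqxx eq_sym (negbTE tt') eqxx mule1 !noise_law // => <-; congr (Pr _).
apply/seteqP; split=> [x [Eo Fo] j _ /=|x h].
  by do 2![case: eqP => _ //].
split; first by have := h t ht; rewrite /= eqxx.
by have := h t' ht'; rewrite /= eq_sym (negbTE tt') eqxx.
Qed.

Lemma noise_moments t t' k l :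
  has_mean (fun o => w t o k 0 * w t' o l 0) (s ^+ 2 * ((t == t') && (k == l))%:R).
Proof.
have [mw _ _] := hw.
pose W j i : {mfun Omega >-> measurableTypeR R} :=
  @mfun_Sub _ _ Omega (measurableTypeR R) (fun o => w j o i 0) (mem_set (mw j i)).
have [<-|tt'] := eqVneq t t'; last first.
  by rewrite mulr0; apply: (@independent_has_mean0 (W t k) (W t' l)) => E F mE mF; exact: noise_law_times.
have [<-|kl] := eqVneq k l; last first.
  by rewrite mulr0; apply: (@independent_has_mean0 (W t k) (W t l)) => E F mE mF; exact: noise_law2.
by rewrite mulr1; apply: (@normal_has_second_moment (W t k)) => E mE; exact: noise_law.
Qed.

End Noise.
End Moments.

(** * Average cost as a trace *)

Lemma tr_qf {R : realType} a n (M : 'M[R]_a) (H : 'M[R]_(a, n)) :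
  \tr (H^T *m M *m H) = \sum_j qf M (col j H).
Proof.
apply: eq_bigr => j _; rewrite /qf mxE [RHS]mxE; apply: eq_bigr => i _.
by rewrite tr_col -row_mul !mxE.
Qed.

Lemma trmx_sum {R : realType} a n (I : Type) (r : seq I) (P : pred I) (X : I -> 'M[R]_(a, n)) :
  (\sum_(i <- r | P i) X i)^T = \sum_(i <- r | P i) (X i)^T.
Proof. exact: linear_sum. Qed.

Lemma tr_quad_sum {R : realType} a n (I : finType) (P : pred I)
    (X : I -> 'M[R]_(a, n)) (M : 'M[R]_a) :
  (forall i j, P i -> P j -> i != j -> X i *m (X j)^T = 0) ->
  \tr ((\sum_(i | P i) X i)^T *m M *m \sum_(i | P i) X i) =
  \sum_(i | P i) \tr ((X i)^T *m M *m X i).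
Proof.
move=> orth; rewrite trmx_sum !mulmx_suml raddf_sum /=; apply: eq_bigr => i Pi.
rewrite mulmx_sumr raddf_sum /= (bigD1 i) //= [X in _ + X]big1 ?addr0 // => j /andP[Pj ji].
by rewrite -mulmxA mxtrace_mulC -mulmxA orth // mulmx0 mxtrace0.
Qed.

Section CostFormula.
Context {R : realType} {p : nat} (G : delay_graph p) (hG : delay_graph_wf G).
Context {n_ m_ : 'I_p -> nat}.
Context (Q : 'M[R]_(\sum_i n_ i)) (Ru : 'M[R]_(\sum_i m_ i)).
Context (A : 'M[R]_(\sum_i n_ i)) (B : 'M[R]_(\sum_i n_ i, \sum_i m_ i)).
Context (Nb : 'I_p -> {set 'I_p}).
Hypothesis hD : forall i j, j \in Nb i -> D_le G i j 1.
Hypothesis hA0 : forall i j, j \notin Nb i -> submxblock A i j = 0.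
Hypothesis hB0 : forall i j, j \notin Nb i -> submxblock B i j = 0.
Context (K : @gain_family R p n_ m_).
Local Notation n := (\sum_i n_ i)%N.
Local Notation cl r := (closed_loop A B K (succ G r) r).

Definition prj (i : 'I_p) : 'M[R]_n := (rst n_ [set i]%SET)^T *m rst n_ [set i]%SET.

Lemma prj_mul i j : prj i *m prj j = if i == j then prj i else 0.
Proof.
rewrite /prj; case: eqVneq => [<-|ij].
  by rewrite mulmxA -(mulmxA _ (rst _ _)) rst_rstT mulmx1.
apply/matrixP => k l; rewrite !mxE; apply: big1 => h _.
rewrite !rstT_rst; case: eqP => [<-|_] /=; last by rewrite mul0r.
rewrite !inE; case: eqP => [->|_]; last by rewrite mul0r.
by rewrite (negbTE ij) andbF mulr0.
Qed.

Lemma prj_sym i : (prj i)^T = prj i.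
Proof. by rewrite /prj trmx_mul trmxK. Qed.

Lemma sum_prj : \sum_i prj i = 1%:M.
Proof.
have -> : \sum_i prj i = \sum_(i in [set: 'I_p]%SET) prj i.
  by apply: eq_bigl => i; rewrite inE.
rewrite sum_rstT_rst; apply/matrixP => k l.
by rewrite rstT_rst !mxE inE andbT.
Qed.

(** [impulse k s] is the matrix by which the noise of k + 1 steps ago enters zeta at s. *)
Fixpoint impulse (k : nat) (s : {set 'I_p}) : 'M[R]_(#|coords n_ s|, n) :=
  if k is k'.+1 then
    \sum_(r in nodes G | info_edge G r s) closed_loop A B K s r *m impulse k' r
  else \sum_(i | s == info G i 0) rst n_ s *m prj i.

Lemma impulse_succ k s : impulse k.+1 s =
  \sum_(r in nodes G | info_edge G r s) closed_loop A B K s r *m impulse k r.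
Proof. by []. Qed.

(** A node has a single successor, so contributions to distinct nodes come from
distinct nodes one step earlier, and at the start from distinct subsystems. *)
Lemma impulse_orth k s s' : s != s' -> impulse k s *m (impulse k s')^T = 0.
Proof.
elim: k s s' => [|k IH] s s' ss'.
  rewrite /= trmx_sum mulmx_suml; apply: big1 => i /eqP si.
  rewrite mulmx_sumr; apply: big1 => j /eqP s'j.
  rewrite trmx_mul prj_sym mulmxA -(mulmxA _ (prj i)) prj_mul.
  case: eqP => [ij|_]; last by rewrite mulmx0 mul0mx.
  by rewrite si s'j ij eqxx in ss'.
rewrite !impulse_succ trmx_sum mulmx_suml; apply: big1 => r /andP[rn].
rewrite (info_edgeE hG) rn /= => /eqP sr.
rewrite mulmx_sumr; apply: big1 => r' /andP[rn'].
rewrite (info_edgeE hG) rn' /= => /eqP sr'.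
rewrite trmx_mul mulmxA -(mulmxA _ (impulse k r)) IH ?mulmx0 ?mul0mx //.
by apply: contra_neq ss' => rr'; rewrite sr sr' rr'.
Qed.

(** Times sw^2, the increment from time k to time k + 1 of the expected sum over
the nodes of the forms M_s at zeta_s. *)
Definition energy (M : @cost_family R p n_) (k : nat) : R :=
  \sum_(s in nodes G) \tr ((impulse k s)^T *m M s *m impulse k s).

Lemma energy_succ (M : @cost_family R p n_) k : energy M k.+1 =
  energy (fun r => (cl r)^T *m M (succ G r) *m cl r) k.
Proof.
rewrite /energy.
have E s : s \in nodes G -> \tr ((impulse k.+1 s)^T *m M s *m impulse k.+1 s) =
  \sum_(r in nodes G | info_edge G r s)
     \tr ((impulse k r)^T *m ((closed_loop A B K s r)^T *m M s *m closed_loop A B K s r) *m impulse k r).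
  move=> sn; rewrite impulse_succ tr_quad_sum => [|r r' _ _ rr'].
    by apply: eq_bigr => r _; rewrite trmx_mul !mulmxA.
  by rewrite trmx_mul mulmxA -(mulmxA _ (impulse k r)) impulse_orth // mulmx0 mul0mx.
rewrite (eq_bigr _ E) (exchange_big_dep (mem (nodes G))) /=; last by move=> s r _ /andP[].
apply: eq_bigr => r rn.
rewrite (bigD1 (succ G r)) /=; last by rewrite rn (succ_nodes hG rn) (info_edgeE hG) rn eqxx.
rewrite [X in _ + X]big1 ?addr0 // => s /andP[/andP[sn /andP[_]]].
by rewrite (info_edgeE hG) rn /= => ->.
Qed.

Lemma energy0 (sw : R) (M : @cost_family R p n_) : trace_cost G sw M = sw ^+ 2 * energy M 0.
Proof.
rewrite /trace_cost /energy; congr (_ * _).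
have E s : s \in nodes G -> \tr ((impulse 0 s)^T *m M s *m impulse 0 s) =
  \sum_(i | s == info G i 0) \tr (subm (1%:M : 'M[R]_n) [set i]%SET s *m M s *m
     subm (1%:M : 'M[R]_n) s [set i]%SET).
  move=> sn; rewrite /= tr_quad_sum => [|i i' _ _ ii'].
    apply: eq_bigr => i _; rewrite !subm1l trmx_mul prj_sym !mulmxA mxtrace_mulC.
    by rewrite /prj !mulmxA rst_rstT mul1mx.
  rewrite trmx_mul prj_sym mulmxA -(mulmxA _ (prj i)) prj_mul (negbTE ii').
  by rewrite mulmx0 mul0mx.
rewrite (eq_bigr _ E) (exchange_big_dep predT) //=.
apply: eq_bigr => i _.
rewrite (bigD1 (info G i 0)) /=; last by rewrite info_nodes eqxx.
by rewrite [X in _ + X]big1 ?addr0 // => s /andP[/andP[_ /eqP ->]]; rewrite eqxx.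
Qed.

Lemma energyE M k : energy M k = \sum_(s in nodes G) \sum_j qf (M s) (col j (impulse k s)).
Proof. by apply: eq_bigr => s _; rewrite tr_qf. Qed.

Lemma energyD M M' k : energy (fun s => M s + M' s) k = energy M k + energy M' k.
Proof.
rewrite !energyE -big_split; apply: eq_bigr => s _; rewrite -big_split.
by apply: eq_bigr => j _; rewrite qfDl.
Qed.

Section Trajectory.
Variable w : nat -> 'cV[R]_n.

Lemma zeta_impulse t s : zeta G A B K w t s = \sum_(k < t) impulse k s *m w (t - k.+1)%N.
Proof.
elim: t s => [|t IH] s; first by rewrite big_ord0.
rewrite big_ord_recl /= addrC subSS subn0; congr (_ + _).
  rewrite mulmx_suml; apply: eq_bigr => i _.
  by rewrite subm1l subvE !mulmxA.
rewrite (eq_bigr (fun r => \sum_(k < t) closed_loop A B K s r *m (impulse k r *m w (t - k.+1)%N))).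
  rewrite exchange_big /=; apply: eq_bigr => k _.
  rewrite mulmx_suml subSS; apply: eq_bigr => r _; by rewrite mulmxA.
by move=> r _; rewrite IH mulmx_sumr.
Qed.

Lemma input_zeta t : input G A B K w t =
  \sum_(s in nodes G) (rst m_ s)^T *m (K s *m zeta G A B K w t s).
Proof.
rewrite /input stackE.
rewrite (eq_bigr (fun i => \sum_(s in nodes G | i \in s)
   ((rst m_ [set i]%SET)^T *m rst m_ [set i]%SET) *m ((rst m_ s)^T *m (K s *m zeta G A B K w t s)))).
  rewrite (exchange_big_dep (mem (nodes G))) /=; last by move=> i s _ /andP[].
  apply: eq_bigr => s sn.
  transitivity (\sum_(i in s) (rst m_ [set i]%SET)^T *m rst m_ [set i]%SET *m
      ((rst m_ s)^T *m (K s *m zeta G A B K w t s))).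
    by apply: eq_bigl => i; rewrite sn.
  by rewrite -mulmx_suml sum_rstT_rst !mulmxA -(mulmxA _ (rst _ _)) rst_rstT mulmx1.
move=> i _; rewrite mulmx_sumr; apply: eq_bigr => s _.
by rewrite subm1l !mulmxA.
Qed.

Lemma state_zeta t : state G A B K w t =
  \sum_(s in nodes G) (rst n_ s)^T *m zeta G A B K w t s.
Proof.
elim: t => [|t IH]; first by apply/esym; apply: big1 => s _; rewrite mulmx0.
rewrite /= IH input_zeta !mulmx_sumr -big_split /=.
rewrite (eq_bigr (fun r => (rst n_ (succ G r))^T *m (cl r *m zeta G A B K w t r))); last first.
  move=> r rn; rewrite /closed_loop mulmxDl mulmxDr !mulmxA.
  by rewrite (propagate hG hD hA0 rn) (propagate hG hD hB0 rn).
rewrite [RHS](eq_bigr (fun s => \sum_(r in nodes G | info_edge G r s)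
    (rst n_ s)^T *m (closed_loop A B K s r *m zeta G A B K w t r) +
    \sum_(i | s == info G i 0) (rst n_ s)^T *m (rst n_ s *m (prj i *m w t)))); last first.
  move=> s sn; rewrite mulmxDr !mulmx_sumr; congr (_ + _).
  by apply: eq_bigr => i _; rewrite subm1l subvE !mulmxA.
rewrite [RHS]big_split /=; congr (_ + _).
  rewrite [RHS](exchange_big_dep (mem (nodes G))) /=; last by move=> s r _ /andP[].
  apply: eq_bigr => r rn.
  rewrite [RHS](bigD1 (succ G r)) /=; last first.
    by rewrite rn (succ_nodes hG rn) (info_edgeE hG) rn eqxx.
  rewrite [X in _ + X]big1 ?addr0 // => s /andP[/andP[sn /andP[_]]].
  by rewrite (info_edgeE hG) rn /= => ->.
rewrite [RHS](exchange_big_dep predT) //=.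
rewrite [RHS](eq_bigr (fun i => prj i *m w t)) => [|i _].
  by rewrite -mulmx_suml sum_prj mul1mx.
rewrite [LHS](bigD1 (info G i 0)) /=; last by rewrite info_nodes eqxx.
rewrite [X in _ + X]big1 ?addr0 => [|s /andP[/andP[_ /eqP ->]]]; last by rewrite eqxx.
apply: rstT_rst_supp => k l kn; rewrite mxE; apply: big1 => h _.
rewrite rstT_rst inE; case: (_ =P i) => [ki|_]; last by rewrite andbF mul0r.
by rewrite ki info_self in kn.
Qed.

Definition state_impulse k : 'M[R]_n := \sum_(s in nodes G) (rst n_ s)^T *m impulse k s.
Definition input_impulse k : 'M[R]_(\sum_i m_ i, n) :=
  \sum_(s in nodes G) (rst m_ s)^T *m (K s *m impulse k s).

Lemma state_impulseE t : state G A B K w t = \sum_(k < t) state_impulse k *m w (t - k.+1)%N.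
Proof.
rewrite state_zeta (eq_bigr (fun s => \sum_(k < t) (rst n_ s)^T *m (impulse k s *m w (t - k.+1)%N))).
  rewrite exchange_big; apply: eq_bigr => k _; rewrite mulmx_suml.
  by apply: eq_bigr => s _; rewrite mulmxA.
by move=> s _; rewrite zeta_impulse mulmx_sumr.
Qed.

Lemma input_impulseE t : input G A B K w t = \sum_(k < t) input_impulse k *m w (t - k.+1)%N.
Proof.
rewrite input_zeta (eq_bigr (fun s => \sum_(k < t)
    (rst m_ s)^T *m (K s *m (impulse k s *m w (t - k.+1)%N)))).
  rewrite exchange_big; apply: eq_bigr => k _; rewrite mulmx_suml.
  by apply: eq_bigr => s _; rewrite !mulmxA.
by move=> s _; rewrite zeta_impulse !mulmx_sumr; apply: eq_bigr => k _.
Qed.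

End Trajectory.

(** The forms of Q and R mix all nodes; orthogonality of the impulse responses removes
every cross term. *)
Lemma energy_stage k :
  \tr ((state_impulse k)^T *m Q *m state_impulse k) + \tr ((input_impulse k)^T *m Ru *m input_impulse k)
  = energy (stage_form Q Ru K) k.
Proof.
have orth s s' : s != s' -> impulse k s *m (impulse k s')^T = 0 by exact: impulse_orth.
have key (a_ : 'I_p -> nat) (M : 'M[R]_(\sum_i a_ i))
    (F : forall s : {set 'I_p}, 'M[R]_(#|coords a_ s|, #|coords n_ s|)) :
  \tr ((\sum_(s in nodes G) (rst a_ s)^T *m (F s *m impulse k s))^T *m M *m
     \sum_(s in nodes G) (rst a_ s)^T *m (F s *m impulse k s)) =
  \sum_(s in nodes G) \tr ((impulse k s)^T *m ((F s)^T *m subm M s s *m F s) *m impulse k s).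
  rewrite tr_quad_sum => [|s s' _ _ ss'].
    by apply: eq_bigr => s _; rewrite submE !trmx_mul trmxK !mulmxA.
  by rewrite !trmx_mul trmxK !mulmxA -(mulmxA _ (impulse k s)) orth // mulmx0 !mul0mx.
rewrite /input_impulse key.
have -> : state_impulse k = \sum_(s in nodes G) (rst n_ s)^T *m (1%:M *m impulse k s).
  by apply: eq_bigr => s _; rewrite mul1mx.
rewrite key -big_split /energy; apply: eq_bigr => s _ /=.
by rewrite trmx1 mul1mx mulmx1 -raddfD /= -mulmxDl -mulmxDr.
Qed.

(** The energy of P drops at each step by the energy of the stage cost, so that
partial sums of the latter telescope. *)
Lemma energy_lyapunov P k : is_lyapunov_family G Q Ru A B K P ->
  energy P k = energy (stage_form Q Ru K) k + energy P k.+1.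
Proof.
move=> hP; rewrite energy_succ -energyD; apply: eq_bigr => s sn.
by rewrite {1}hP.
Qed.

Section Mean.
Context {dO : measure_display} {Omega : measurableType dO} (Pr : probability Omega R).
Variables (sw : R) (w : nat -> Omega -> 'cV[R]_n).
Hypotheses (hsw : 0 < sw) (hw : iid_gaussian Pr sw w).

(** Only equal times and equal coordinates are correlated, which leaves the trace. *)
Lemma bilinear_mean (M : 'M[R]_n) t t' :
  has_mean Pr (fun o => ((w t o)^T *m M *m w t' o) 0 0) (sw ^+ 2 * ((t == t')%:R * \tr M)).
Proof.
have E o : ((w t o)^T *m M *m w t' o) 0 0 =
    \sum_j \sum_i M i j * (w t o i 0 * w t' o j 0).
  rewrite mxE; apply: eq_bigr => j _; rewrite mxE mulr_suml; apply: eq_bigr => i _.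
  by rewrite !mxE mulrAC mulrC.
under [fun _ => _]funext do rewrite E.
apply: (has_mean_eq (a := \sum_j \sum_i M i j * (sw ^+ 2 * ((t == t') && (i == j))%:R))).
  rewrite /mxtrace !mulr_sumr; apply: eq_bigr => j _; rewrite (bigD1 j) //= [X in _ + X]big1.
    by rewrite eqxx andbT addr0 mulrCA; congr (_ * _); rewrite mulrC.
  by move=> i ij; rewrite (negbTE ij) andbF !mulr0.
apply: has_mean_sum => j _; apply: has_mean_sum => i _; apply: has_meanZ.
exact: noise_moments.
Qed.

Lemma quad_mean a (S : 'M[R]_a) (C : nat -> 'M[R]_(a, n)) t :
  has_mean Pr (fun o => qf S (\sum_(k < t) C k *m w (t - k.+1)%N o))
    (sw ^+ 2 * \sum_(k < t) \tr ((C k)^T *m S *m C k)).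
Proof.
have E o : qf S (\sum_(k < t) C k *m w (t - k.+1)%N o) =
    \sum_(k < t) \sum_(l < t)
      ((w (t - k.+1)%N o)^T *m ((C k)^T *m S *m C l) *m w (t - l.+1)%N o) 0 0.
  rewrite /qf trmx_sum !mulmx_suml summxE; apply: eq_bigr => k _.
  rewrite mulmx_sumr summxE; apply: eq_bigr => l _.
  by rewrite trmx_mul !mulmxA.
under [fun _ => _]funext do rewrite E.
apply: (has_mean_eq (a := \sum_(k < t) \sum_(l < t)
   sw ^+ 2 * (((t - k.+1)%N == (t - l.+1)%N)%:R * \tr ((C k)^T *m S *m C l)))).
  rewrite mulr_sumr; apply: eq_bigr => k _; rewrite (bigD1 k) //= [X in _ + X]big1.
    by rewrite eqxx mul1r addr0.
  move=> l lk; suff /negbTE -> : (t - k.+1)%N != (t - l.+1)%N by rewrite mul0r mulr0.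
  apply: contra_neq lk => kl; apply/val_inj => /=.
  have := ltn_ord k; have := ltn_ord l; lia.
by apply: has_mean_sum => k _; apply: has_mean_sum => l _; exact: bilinear_mean.
Qed.

Lemma stage_mean t :
  has_mean Pr (fun o => stage_cost G Q Ru A B K (fun t' => w t' o) t)
    (sw ^+ 2 * \sum_(k < t) energy (stage_form Q Ru K) k).
Proof.
have E o : stage_cost G Q Ru A B K (fun t' => w t' o) t =
  qf Q (\sum_(k < t) state_impulse k *m w (t - k.+1)%N o) +
  qf Ru (\sum_(k < t) input_impulse k *m w (t - k.+1)%N o).
  by rewrite /stage_cost mxE state_impulseE input_impulseE.
under [fun _ => _]funext do rewrite E.
apply: has_mean_eq (has_meanD (quad_mean Q state_impulse t) (quad_mean Ru input_impulse t)).
rewrite -mulrDr -big_split /=; congr (_ * _); apply: eq_bigr => k _.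
exact: energy_stage.
Qed.

Section Limit.
Local Open Scope classical_set_scope.
Variables (P P' : @cost_family R p n_) (rho c : R).
Hypothesis hP : is_lyapunov_family G Q Ru A B K P.
Hypotheses (rho01 : 0 <= rho < 1) (c0 : 0 <= c).
Hypothesis hP' : forall r, r \in nodes G -> forall x,
  qf (P' (succ G r)) (cl r *m x) <= rho * qf (P' r) x.
Hypothesis PP' : forall r, r \in nodes G -> forall x, `|qf (P r) x| <= c * qf (P' r) x.

Lemma energy_decay k : energy P' k <= rho ^+ k * energy P' 0.
Proof.
elim: k => [|k IH]; first by rewrite mul1r.
have /andP[rho0 _] := rho01.
apply: (@le_trans _ _ (rho * energy P' k)); last by rewrite exprS -mulrA ler_wpM2l.
rewrite energy_succ !energyE mulr_sumr; apply: ler_sum => s sn.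
rewrite mulr_sumr; apply: ler_sum => j _; rewrite qf_congr; exact: hP'.
Qed.

Lemma energy_cvg0 : energy P k @[k --> \oo] --> (0 : R).
Proof.
have bd k : `|energy P k| <= c * energy P' 0 * rho ^+ k.
  apply: (@le_trans _ _ (c * energy P' k)); last first.
    by rewrite mulrAC -mulrA ler_wpM2l // energy_decay.
  rewrite !energyE mulr_sumr; apply: le_trans (ler_norm_sum _ _ _) _.
  apply: ler_sum => s sn; rewrite mulr_sumr; apply: le_trans (ler_norm_sum _ _ _) _.
  by apply: ler_sum => j _; exact: PP'.
have /andP[rho0 rho1] := rho01.
have cv : c * energy P' 0 * rho ^+ k @[k --> \oo] --> (0 : R).
  rewrite -[X in _ --> X](mulr0 (c * energy P' 0)); apply: cvgMr.
  by apply: cvg_expr; rewrite ger0_norm.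
apply/cvgr0Pnorm_lt => e e0; near=> k; apply: le_lt_trans (bd k) _.
near: k; exact: (cvgr_lt _ cv).
Unshelve. all: by end_near.
Qed.

Lemma energy_telescope t :
  \sum_(k < t) energy (stage_form Q Ru K) k = energy P 0 - energy P t.
Proof.
elim: t => [|t IH]; first by rewrite big_ord0 subrr.
by rewrite big_ord_recr /= IH (energy_lyapunov t hP); ring.
Qed.

(** The expected stage cost at time t is sw^2 times the energy of P at 0 minus that
at t. The latter tends to 0, and Cesaro means have the same limit. *)
Lemma mean_cost_cvg : mean_cost Pr G Q Ru A B K w T @[T --> \oo] --> (trace_cost G sw P)%:E.
Proof.
pose u t := sw ^+ 2 * (energy P 0 - energy P t).
have meanE T : mean_cost Pr G Q Ru A B K w T = (T%:R^-1 * \sum_(t < T) u t)%:E.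
  apply: has_mean_expectation; apply: has_meanZ; apply: has_mean_sum => t _.
  by rewrite /u -energy_telescope; exact: stage_mean.
have ucv : u t @[t --> \oo] --> trace_cost G sw P.
  rewrite energy0 -[in X in _ --> X](subr0 (energy P 0)); apply: cvgMr.
  by apply: cvgB; [exact: cvg_cst|exact: energy_cvg0].
under eq_fun do rewrite meanE.
apply: cvg_EFin; first by near=> t.
rewrite -cvg_shiftS; apply: cvg_trans (cesaro ucv); apply: near_eq_cvg.
by near=> t; rewrite /arithmetic_mean /series /= big_mkord.
Unshelve. all: by end_near.
Qed.

End Limit.
End Mean.
End CostFormula.

(** * Certainty equivalence *)

Lemma nodes_coords {p : nat} (G : delay_graph p) (a_ : 'I_p -> nat) (k : 'I_(\sum_i a_ i)) :
  exists2 s, s \in nodes G & forall R : realType,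
    exists x : 'cV[R]_#|coords a_ s|, sqn x = 1.
Proof.
exists (info G (tagnat.sig1 k) 0); first exact: info_nodes.
move=> R; exists (rst a_ (info G (tagnat.sig1 k) 0) *m delta_mx k 0).
rewrite -sqn_rstT rstT_rst_supp => [|i j ik].
  by rewrite /sqn trmx_delta -rowE !mxE !eqxx.
rewrite mxE; case: (i =P k) => // ik'.
by rewrite ik' info_self in ik.
Qed.

(** Each subsystem belongs to the node that its noise enters, so its block of the
identity survives and the traces add up to the dimension. *)
Lemma trace_cost_id {R : realType} {p : nat} (G : delay_graph p) (n_ : 'I_p -> nat) (sw : R) :
  trace_cost G (n_ := n_) sw (fun s => 1%:M) = sw ^+ 2 * (\sum_i n_ i)%:R.
Proof.
have -> : (\sum_i n_ i)%:R = \sum_i \tr (prj i : 'M[R]_(\sum_i n_ i)).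
  by rewrite -(mxtrace1 R) -sum_prj raddf_sum.
rewrite /trace_cost; congr (_ * _).
apply: eq_bigr => i _ /=; rewrite !subm1l mulmx1 -mulmxA rstT_rst_supp.
  by rewrite mxtrace_mulC.
move=> k l ki; rewrite mxE rstE; case: eqP => // lk.
by have := enum_valP l; rewrite lk !inE => /eqP ki'; rewrite ki' info_self in ki.
Qed.

Section CostGap.
Context {R : realType} {p : nat} (G : delay_graph p) {n_ : 'I_p -> nat}.

Lemma qf_mx1 a n (M : 'M[R]_a) (H : 'M[R]_(a, n)) c :
  (forall x, qf M x <= c * sqn x) -> \tr (H^T *m M *m H) <= c * \tr (H^T *m 1%:M *m H).
Proof.
move=> Mc; rewrite !tr_qf mulr_sumr; apply: ler_sum => j _.
by rewrite qf_id; exact: Mc.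
Qed.

Lemma trace_cost_le (sw c : R) (M M' : @cost_family R p n_) :
  (forall s, s \in nodes G -> forall x, qf (M s) x - qf (M' s) x <= c * sqn x) ->
  trace_cost G sw M - trace_cost G sw M' <= c * (sw ^+ 2 * (\sum_i n_ i)%:R).
Proof.
move=> h; rewrite -(trace_cost_id G) /trace_cost -mulrBr mulrCA.
rewrite ler_wpM2l ?sqr_ge0 // -sumrB mulr_sumr; apply: ler_sum => i _ /=.
set s := info G i 0; rewrite -raddfB /= -mulmxBl -mulmxBr.
have -> : subm (1%:M : 'M[R]_(\sum_i n_ i)) [set i]%SET s =
    (subm (1%:M : 'M[R]_(\sum_i n_ i)) s [set i]%SET)^T.
  by rewrite !subm1l trmx_mul trmxK.
apply: qf_mx1 => x.
have -> : qf (M s - M' s) x = qf (M s) x - qf (M' s) x.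
  by rewrite qfDl -scaleN1r qfZ mulN1r.
exact: h (info_nodes G i 0) x.
Qed.

End CostGap.

Section CertaintyEquivalence.
Context {R : realType} {p : nat} (G : delay_graph p) (hG : delay_graph_wf G).
Context {n_ m_ : 'I_p -> nat}.
Context (Q : 'M[R]_(\sum_i n_ i)) (Ru : 'M[R]_(\sum_i m_ i)).
Hypotheses (hQ : psd Q) (hQ1 : forall x, sqn x <= qf Q x).
Hypotheses (hR : pd Ru) (hR1 : forall x, sqn x <= qf Ru x).
Variables (A A' : 'M[R]_(\sum_i n_ i)) (B B' : 'M[R]_(\sum_i n_ i, \sum_i m_ i)).
Variables (P : @cost_family R p n_) (g eps : R).
Hypothesis hP : is_riccati_family G Q Ru A B P.
Hypothesis Pg : forall r, r \in nodes G -> forall x, qf (P r) x <= g * sqn x.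
Hypotheses (g1 : 1 <= g) (eps0 : 0 < eps) (epsb : 48 * (g + 1) ^+ 2 * eps <= 1).
Hypotheses (hA : specnorm (A' - A) <= eps) (hB : specnorm (B' - B) <= eps).

Let P' := riccati_cost G Q Ru A' B'.
Let K' := riccati_gain G Q Ru A' B'.
Let X := lyapunov_cost G Q Ru A B K'.

Let g0 : 0 < g. Proof. exact: lt_le_trans g1. Qed.

Let b1 : g * (g + 1) * eps <= 1 / 48.
Proof.
rewrite ler_pdivlMr // mulrC !mulrA; apply: le_trans epsb.
rewrite ler_wpM2r ?(ltW eps0) // -mulrA ler_wpM2l // expr2 ler_wpM2r //;
  by move: g1; lra.
Qed.

Let b2 : (g + 1) * eps <= 1 / 48.
Proof.
apply: le_trans b1; rewrite ler_wpM2r ?(ltW eps0) // ler_peMl //; by move: g1; lra.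
Qed.

Let b0 : 0 < (g + 1) * eps.
Proof. by rewrite mulr_gt0 // addr_gt0. Qed.

Let dl01 : 0 < (g + 1) * eps <= 1.
Proof. by rewrite b0 /=; move: b2; lra. Qed.
Let gdl : 3 * g * ((g + 1) * eps) < 1.
Proof. by rewrite -mulrA (mulrA g); move: b1; lra. Qed.
(** The closed loops differ by at most eps times the square root of 2 (1 + g), which
g >= 1 bounds by (g + 1) eps. *)
Let hdl : 2 * eps ^+ 2 * (1 + g) <= ((g + 1) * eps) ^+ 2.
Proof.
by rewrite exprMn [leRHS]mulrC mulrAC [leLHS]mulrC ler_wpM2l ?sqr_ge0 //; move: g1; nra.
Qed.

Let hatR : is_riccati_family G Q Ru A' B' P'.
Proof. exact: (nearby_riccati hG hQ hQ1 hR hR1 hP Pg g1 dl01 gdl hA hB hdl). Qed.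

Let hat_le r : r \in nodes G -> forall x,
  (1 - 3 * g * ((g + 1) * eps)) * qf (P' r) x <= qf (P r) x.
Proof. exact: (riccati_le hG hQ hQ1 hR hR1 hP Pg g1 dl01 gdl hA hB hdl hatR). Qed.

Let hat_ge0 r x : r \in nodes G -> 0 <= qf (P' r) x.
Proof. by move=> rn; exact: (riccati_family_psd hG hQ hR hR1 hatR rn).2. Qed.

Let hat_g r : r \in nodes G -> forall x, qf (P' r) x <= 2 * g * sqn x.
Proof.
move=> rn x; have := hat_le rn x; have := Pg rn x; have := hat_ge0 x rn.
rewrite -mulrA (mulrA g) -(mulrA 2); have := sqn_ge0 x; move: b1.
move: (qf (P' r) x) (qf (P r) x) (g * (g + 1) * eps) (g * sqn x) => a b c d; nra.
Qed.

Let g1_hat : 1 <= 2 * g. Proof. by move: g1; lra. Qed.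
Let dl01_hat : 0 < 2 * ((g + 1) * eps) <= 1.
Proof. by apply/andP; split; [rewrite mulr_gt0|move: b2; lra]. Qed.
Let gdl_hat : 3 * (2 * g) * (2 * ((g + 1) * eps)) < 1.
Proof.
have -> : 3 * (2 * g) * (2 * ((g + 1) * eps)) = 12 * (g * (g + 1) * eps) by ring.
by move: b1; lra.
Qed.
Let hdl_hat : 2 * eps ^+ 2 * (1 + 2 * g) <= (2 * ((g + 1) * eps)) ^+ 2.
Proof. by have := sqr_ge0 eps; move: g1; rewrite !exprMn; nra. Qed.

Let specnormN a b (M M' : 'M[R]_(a, b)) : specnorm (M - M') = specnorm (M' - M).
Proof.
rewrite /specnorm /sigma /singular_values -[in LHS](opprB M' M).
by rewrite [(- (M' - M))^T]linearN /= mulNmx mulmxN opprK.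
Qed.

Let hA' : specnorm (A - A') <= eps. Proof. by rewrite specnormN. Qed.
Let hB' : specnorm (B - B') <= eps. Proof. by rewrite specnormN. Qed.

Lemma certainty_equivalent_lyapunov : is_lyapunov_family G Q Ru A B K' X.
Proof. exact: (nearby_lyapunov hG hQ hQ1 hR hR1 hatR hat_g g1_hat dl01_hat gdl_hat hA' hB' hdl_hat). Qed.

(** Passing from P to the estimated optimum loses the factor
1 - 3 g (g+1) eps. Passing from there to the cost of the estimated gains on the true
system loses 1 - 3 (2 g) (2 (g+1) eps), the bound g being doubled. The product is at
least 1 - 15 g (g+1) eps, whose inverse is at most 1 + 30 g (g+1) eps. *)
Lemma certainty_equivalent_gap r : r \in nodes G -> forall x,
  qf (X r) x - qf (P r) x <= 30 * g ^+ 2 * (g + 1) * eps * sqn x.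
Proof.
move=> rn x.
have := lyapunov_le hG hQ hQ1 hR hR1 hatR hat_g g1_hat dl01_hat gdl_hat hA' hB' hdl_hat
  certainty_equivalent_lyapunov rn x.
have -> : 3 * (2 * g) * (2 * ((g + 1) * eps)) = 12 * (g * (g + 1) * eps) by ring.
have := hat_le rn x; rewrite -mulrA (mulrA g).
have := hat_ge0 x rn; have := (riccati_family_psd hG hQ hR hR1 hP rn).2 x.
rewrite -/(qf (P r) x); have := Pg rn x; have s0 := sqn_ge0 x.
have c0 : 0 <= g * (g + 1) * eps by rewrite -mulrA mulr_ge0 // ltW.
have -> : 30 * g ^+ 2 * (g + 1) * eps * sqn x = 30 * (g * (g + 1) * eps) * (g * sqn x) by ring.
move: b1 c0; move: (g * (g + 1) * eps) (g * sqn x) => c d cb c0.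
move: (qf (X r) x) (qf (P r) x) (qf (P' r) x) => u v h vd v0 h0 hv uh.
have h2 : (1 - 15 * c) * u <= v.
  have [u0|u0] := leP 0 u; last by nra.
  apply: le_trans hv; apply: le_trans (_ : (1 - 3 * c) * ((1 - 12 * c) * u) <= _).
    by rewrite mulrA ler_wpM2r //; nra.
  by rewrite ler_wpM2l //; lra.
have : u <= (1 + 30 * c) * v.
  have : (1 - 15 * c) * u <= (1 - 15 * c) * ((1 + 30 * c) * v).
    apply: le_trans h2 _; rewrite mulrA ler_peMl //.
    by have := mulr_ge0 c0 c0; nra.
  by rewrite ler_pM2l //; lra.
have : 30 * c * v <= 30 * c * d by rewrite ler_wpM2l // mulr_ge0.
lra.
Qed.

Section Cost.
Variables (Nb : 'I_p -> {set 'I_p}).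
Hypothesis hD : forall i j, j \in Nb i -> D_le G i j 1.
Hypothesis hA0 : forall i j, j \notin Nb i -> submxblock A i j = 0.
Hypothesis hB0 : forall i j, j \notin Nb i -> submxblock B i j = 0.
Context {dO : measure_display} {Omega : measurableType dO} (Pr : probability Omega R).
Variables (sw : R) (w : nat -> Omega -> 'cV[R]_(\sum_i n_ i)).
Hypotheses (hsw : 0 < sw) (hw : iid_gaussian Pr sw w).

Lemma certainty_equivalent_cost :
  (mean_cost Pr G Q Ru A B K' w T @[T --> \oo] --> (trace_cost G sw X)%:E)%classic.
Proof.
have [c c0 hc] := family_abs_bound X.
apply: (mean_cost_cvg hG hD hA0 hB0 hsw hw certainty_equivalent_lyapunov
  (rate_bounds g1_hat dl01_hat gdl_hat) c0).
  exact: (nearby_contraction hG hQ hQ1 hR hR1 hatR hat_g g1_hat dl01_hat gdl_hat hA' hB' hdl_hat).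
move=> r rn x; apply: le_trans (hc r x) _; apply: ler_wpM2l => //.
exact: (nearby_riccati_ge1 hG hQ hQ1 hR hR1 hatR).
Qed.

End Cost.
End CertaintyEquivalence.

Lemma eps_small {R : realFieldType} (x k t y b eps : R) (d : nat) :
  0 < x <= 1 -> 1 <= k -> 1 <= t -> 1 <= y -> 1 <= b ->
  eps <= 1 / 768 * (x / k) / t ^+ 11 / y ^+ 2 / b ^+ d -> 48 * t ^+ 2 * eps <= 1.
Proof.
move=> /andP[x0 x1] k1 t1 y1 b1 h.
have shrink (a z : R) : 0 <= a -> 1 <= z -> a / z <= a.
  by move=> a0 z1; rewrite ler_piMr // invf_le1 // (lt_le_trans ltr01).
have t0 : 0 < t by exact: lt_le_trans t1.
have xk : 0 <= x / k by rewrite divr_ge0 // ltW // (lt_le_trans ltr01).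
have {h}h : eps <= 1 / 768 / t ^+ 11.
  have : (0 : R) <= 1 / 768 by lra.
  move: (1 / 768) h => c h c0.
  have t11 : 0 <= (t ^+ 11)^-1 by rewrite invr_ge0 exprn_ge0 // ltW.
  have a0 : 0 <= c * (x / k) / t ^+ 11 by apply: mulr_ge0 => //; exact: mulr_ge0.
  apply: le_trans h _; apply: le_trans (shrink _ _ _ (exprn_ege1 _ b1)) _.
    by rewrite divr_ge0 // exprn_ge0 // (le_trans ler01).
  apply: le_trans (shrink _ _ a0 (exprn_ege1 _ y1)) _.
  rewrite ler_wpM2r // ler_piMr // (le_trans (shrink _ _ (ltW x0) k1)) //.
have e : 48 * t ^+ 2 * (1 / 768 / t ^+ 11) = 1 / 16 / t ^+ 9.
  by field; rewrite gt_eqF.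
have t2 : 0 <= 48 * t ^+ 2 by rewrite mulr_ge0 ?ler0n // exprn_ge0 // ltW.
have := ler_wpM2l t2 h; rewrite e => {}h; apply: le_trans h _.
have c0 : (0 : R) <= 1 / 16 by lra.
by apply: le_trans (shrink _ _ c0 (exprn_ege1 _ t1)) _; lra.
Qed.

(** With 30 <= 72, g^2 (g + 1) <= (g + 1)^3 and all other factors at least 1. *)
Lemma gap_constant {R : realFieldType} (x k g s si b z nn pp qq eps : R) (d : nat) :
  0 < x <= 1 -> 1 <= k -> 1 <= g -> 1 <= s -> 0 <= si -> 1 <= b ->
  0 <= z -> 0 <= nn -> 1 <= pp -> 1 <= qq -> 0 <= eps ->
  30 * g ^+ 2 * (g + 1) * eps * (z * nn) <=
  72 * k * z * nn * pp * qq / x * (g + 1) ^+ (4 * d + 8) * (g ^+ 3 + s) * (1 + si)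
    * b ^+ d * eps.
Proof.
move=> /andP[x0 x1] k1 g1 s1 si0 b1 z0 nn0 p1 q1 e0.
have : (3 <= 4 * d + 8)%N by exact: leq_trans (leq_addl _ _).
move: (4 * d + 8)%N => e e3.
have g0 : 0 <= g by exact: le_trans g1.
pose W := k * pp * qq * x^-1 * (g ^+ 3 + s) * (1 + si) * b ^+ d.
have W1 : 1 <= W.
  rewrite /W !mulr_ege1 ?exprn_ege1 ?invf_ge1 //.
    by rewrite (le_trans s1) // lerDr exprn_ge0.
  by rewrite lerDl.
have -> : 72 * k * z * nn * pp * qq / x * (g + 1) ^+ e * (g ^+ 3 + s) *
    (1 + si) * b ^+ d * eps = 72 * (g + 1) ^+ e * W * eps * (z * nn).
  by rewrite /W; move: (_ ^+ e) (b ^+ d) (x^-1) => u v w; ring.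
have t1 : 1 <= g + 1 by rewrite lerDr.
have t3 : g ^+ 2 * (g + 1) <= (g + 1) ^+ e.
  apply: le_trans (_ : (g + 1) ^+ 3 <= _); last exact: ler_weXn2l.
  rewrite [leRHS]exprSr ler_wpM2r ?(le_trans ler01 t1) // lerXn2r // ?nnegrE ?(le_trans ler01 t1) //.
  by rewrite lerDl.
rewrite ler_wpM2r ?mulr_ge0 // ler_wpM2r //.
apply: le_trans (_ : 72 * (g + 1) ^+ e <= _); last first.
  by rewrite ler_peMr // mulr_ge0 // exprn_ge0 // (le_trans ler01 t1).
have : 0 <= g ^+ 2 * (g + 1) by rewrite mulr_ge0 ?exprn_ge0 // (le_trans ler01 t1).
by rewrite -mulrA; lra.
Qed.

Theorem proposition3
  (R : realType) (p : nat) (hp : (0 < p)%N)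
  (n_ m_ : 'I_p -> nat) (hnm : forall i, (m_ i <= n_ i)%N)
  (G : delay_graph p) (hG : delay_graph_wf G)
  (A : 'M[R]_(\sum_i n_ i)) (B : 'M[R]_(\sum_i n_ i, \sum_i m_ i))
  (Nb : 'I_p -> {set 'I_p})
  (hA0 : forall i j, j \notin Nb i -> submxblock A i j = 0)
  (hB0 : forall i j, j \notin Nb i -> submxblock B i j = 0)
  (hD : forall i j, j \in Nb i -> D_le G i j 1)
  (Q : 'M[R]_(\sum_i n_ i)) (Ru : 'M[R]_(\sum_i m_ i))
  (hQ : psd Q) (hR : pd Ru)
  (dO : measure_display) (Omega : measurableType dO) (Pr : probability Omega R)
  (sw : R) (hsw : 0 < sw)
  (w : nat -> Omega -> 'cV[R]_(\sum_i n_ i)) (hw : iid_gaussian Pr sw w)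
  (Ahat : 'M[R]_(\sum_i n_ i)) (Bhat : 'M[R]_(\sum_i n_ i, \sum_i m_ i))
  (kap_ gam_ : {set 'I_p} -> R) (kap0 gam0 eps : R) :
  let n := (\sum_i n_ i)%N in
  let m := (\sum_i m_ i)%N in
  let q := #|nodes G| in
  let P := riccati_cost G Q Ru A B in
  let K := riccati_gain G Q Ru A B in
  let Khat := riccati_gain G Q Ru Ahat Bhat in
  let Ptilde := lyapunov_cost G Q Ru A B Khat in
  let Jstar := trace_cost G sw P in
  let cost := mean_cost Pr G Q Ru A B Khat w in
  let Jtilde := limn cost in
  let gam := \big[Num.max/gam0]_(s in roots G) gam_ s in
  let kap := \big[Num.max/kap0]_(s in roots G) kap_ s in
  let Gam := Num.max (Num.max (specnorm A) (specnorm B))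
               (Num.max (\big[Num.max/0]_(s in nodes G) specnorm (P s))
                        (\big[Num.max/0]_(s in nodes G) specnorm (K s))) in
  let Gamt := Gam + 1 in
  (forall s, s \in roots G ->
     [/\ 1 <= kap_ s, spectral_radius (closed_loop A B K s s) < gam_ s, gam_ s < 1
       & forall k, specnorm (closed_loop A B K s s ^+ k) <= kap_ s * gam_ s ^+ k]) ->
  (forall s, s \in roots G ->
     stabilizable (subm A s s) (subm B s s) /\
     exists (l : nat) (C : 'M[R]_(l, #|coords n_ s|)),
       subm Q s s = C^T *m C /\ detectable (subm A s s) C) ->
  1 <= sigma m Ru -> 1 <= sigma n Q ->
  stable A -> 1 <= kap0 -> spectral_radius A < gam0 -> gam0 < 1 ->
  (forall k, specnorm (A ^+ k) <= kap0 * gam0 ^+ k) ->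
  specnorm (Ahat - A) <= eps -> specnorm (Bhat - B) <= eps -> 0 < eps ->
  eps <= 1 / 768 * ((1 - gam ^+ 2) ^+ 2 / kap ^+ 4) * Gamt ^- 11
         * (1 + sigma 1 (invmx Ru)) ^- 2
         * (20 * Gamt ^+ 9 * sigma 1 Ru) ^- Dmax G ->
  [/\ cvgn cost,
      Jtilde = (trace_cost G sw Ptilde)%:E
    & forall phi : R, 0 < phi ->
      (Jtilde - Jstar%:E <=
        (72 * kap ^+ 4 * sw ^+ 2 * n%:R * p%:R * q%:R / (1 - gam ^+ 2) ^+ 2
         * Gamt ^+ (4 * Dmax G + 8) * (Gam ^+ 3 + sigma 1 Ru)
         * (1 + sigma 1 (invmx Ru)) * (20 * Gamt ^+ 9 * sigma 1 Ru) ^+ Dmax G * eps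
         + phi)%:E)%E].
Proof.
move=> n m q P K Khat Ptilde Jstar cost Jtilde gam kap Gam Gamt hcl _ sR sQ.
move=> _ kap01 rho0 gam01 Apow hA hB eps0 epsb.
have hQ1 x : sqn x <= qf Q x by exact: psd_sigma_ge1.
have hR1 x : sqn x <= qf Ru x by apply: psd_sigma_ge1 => //; exact: pd_psd.
have sig_pos a (M : 'M[R]_a) : 1 <= sigma a M -> (0 < a)%N.
  rewrite /sigma; case: a M => // M; rewrite nth_default ?size_singular_values //.
  by rewrite ler10.
have n0 : (0 < n)%N by exact: sig_pos sQ.
have m0 : (0 < m)%N by exact: sig_pos sR.
have gam0p : 0 < gam0.
  by apply: le_lt_trans rho0; rewrite /spectral_radius; exact: bigmax_ge_id.
have hP : is_riccati_family G Q Ru A B P.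
  apply: (stable_riccati hG hQ hR hR1 B hD hA0 _ Apow).
  by rewrite (ltW gam0p).
have GamP s : s \in nodes G -> specnorm (P s) <= Gam.
  move=> sn; rewrite /Gam le_max; apply/orP; right; rewrite le_max; apply/orP; left.
  exact: (le_bigmax_cond _ (fun s => specnorm (P s)) sn).
have Gam0 : 0 <= Gam by rewrite /Gam !le_max specnorm_ge0.
(* A unit vector exists because n > 0, and P is at least the identity form. *)
have Gam1 : 1 <= Gam.
  have [s sn /(_ R)[x x1]] := nodes_coords G (Ordinal n0).
  rewrite leNgt; apply/negP => Glt.
  have : qf (P s) x <= (1 + Gam) / 2 * sqn x.
    apply: qf_le_specnorm; first by rewrite divr_gt0 // ltr_pwDl.
    by apply: le_trans (GamP s sn) _; lra.
  have := nearby_riccati_ge1 hG hQ hQ1 hR hR1 hP x sn; rewrite x1; lra.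
have Pg s (sn : s \in nodes G) x : qf (P s) x <= Gam * sqn x.
  by apply: qf_le_specnorm (GamP s sn); exact: lt_le_trans Gam1.

have Gamt2 : 2 <= Gamt by rewrite /Gamt; move: Gam1; lra.
have sR1 : 1 <= sigma 1 Ru.
  by apply: le_trans sR _; apply: singular_values_sorted; rewrite /= prednK.
have sRi : 0 <= sigma 1 (invmx Ru) by exact: specnorm_ge0.
have gam_lt1 : gam < 1 by apply/bigmax_ltP; split=> // s /hcl[].
have gam_gt0 : 0 < gam by apply: lt_le_trans gam0p _; exact: bigmax_ge_id.
have kap1 : 1 <= kap by apply: le_trans kap01 _; exact: bigmax_ge_id.
have gam2 : 0 < (1 - gam ^+ 2) ^+ 2 <= 1.
  have g2 : 0 < gam ^+ 2 < 1 by rewrite exprn_gt0 // exprn_ilt1 // ltW.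
  have /andP[g2a g2b] := g2.
  by rewrite exprn_gt0 ?subr_gt0 //= exprn_ile1 // ?subr_ge0 ?(ltW g2b) // gerBl ltW.
have base1 : 1 <= 20 * Gamt ^+ 9 * sigma 1 Ru.
  apply: mulr_ege1 => //; apply: mulr_ege1; first by rewrite ler1n.
  by apply: exprn_ege1; apply: le_trans Gamt2; rewrite ler1n.
have Gamt1 : 1 <= Gamt by apply: le_trans Gamt2; rewrite ler1n.
have epsG : 48 * (Gam + 1) ^+ 2 * eps <= 1.
  apply: (eps_small gam2 _ Gamt1 _ base1 epsb); first by rewrite exprn_ege1.
  by rewrite lerDl.
have cv := certainty_equivalent_cost hG hQ hQ1 hR hR1 hP Pg Gam1 eps0 epsG hA hB
  hD hA0 hB0 hsw hw.
have JE : Jtilde = (trace_cost G sw Ptilde)%:E by exact: (cvg_lim _ cv).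
split=> //; first by apply/cvg_ex; exists (trace_cost G sw Ptilde)%:E.
move=> phi phi0; rewrite JE -EFinB lee_fin; apply: ler_wpDr (ltW phi0) _.
apply: le_trans (trace_cost_le _ (certainty_equivalent_gap hG hQ hQ1 hR hR1 hP Pg
  Gam1 eps0 epsG hA hB)) _.
have p1 : 1 <= p%:R :> R by rewrite ler1n.
have q1 : 1 <= q%:R :> R.
  have [s sn _] := nodes_coords G (Ordinal n0).
  by rewrite ler1n; apply/card_gt0P; exists s.
exact: (gap_constant _ gam2 (exprn_ege1 4 kap1) Gam1 sR1 sRi base1 (sqr_ge0 sw)
  (ler0n _ _) p1 q1 (ltW eps0)).
Qed.
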